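(* Let $d\ge1$, $r\ge 2$ and $\vec e=(e_1,\dots,e_r)$ be integers with $2\le e_i\le d$ for all $i$ and $2d-2=\sum_{i=1}^r(e_i-1)$. Suppose $(\sigma_1,\dots,\sigma_r)$ and $(\sigma'_1,\dots,\sigma'_r)$ are two Hurwitz factorizations for $(d,r,0,\vec e)$, generating groups $G,G'\subseteq S_d$ respectively. Then there exists a simultaneous conjugation in $S_d$ making $G'=G$ and each $\sigma_i$ conjugate to $\sigma'_i$ inside $G$; that is, there is $\tau\in S_d$ with $\tau G'\tau^{-1}=G$ and such that for every $i$ the element $\tau\sigma'_i\tau^{-1}$ is conjugate to $\sigma_i$ by an element of $G$. In fact: if $r=2$, then $G$ is isomorphic to the cyclic group $C_d$. If $r=3$ and $(e_1,e_2,e_3)=(4,4,5)$ up to reordering (so $d=6$), then $G\cong S_5$, embedded as a doubly transitive subgroup of $S_6$. In all other cases $G=S_d$ or $G=A_d$, depending on the parity of the $e_i$ (namely $G=A_d$ if all $e_i$ are odd, and $G=S_d$ otherwise).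
   Context: A Hurwitz factorization for $(d,r,0,\vec e)$ is a tuple $(\sigma_1,\dots,\sigma_r)$ of elements of $S_d$ such that $\sigma_i$ is an $e_i$-cycle for each $i$, $\sigma_1\sigma_2\cdots\sigma_r=1$, and $\sigma_1,\dots,\sigma_r$ generate a transitive subgroup of $S_d$. *)

(* Defs.v *)
From mathcomp Require Export all_boot all_order all_algebra all_fingroup.
From mathcomp Require Export all_solvable.

Set Implicit Arguments.
Unset Strict Implicit.
Unset Printing Implicit Defensive.

Local Open Scope group_scope.

(* Products in 'S_d are those of perm.v, where [s * t] means "s, then t".
   Inverting every entry turns factorizations for this convention into
   factorizations for the opposite one and preserves all the groups below.
   Accordingly [s ^ t] is the function t o s o t^-1. *)

(* For e = 1 this is the identity. *)
Definition is_ecycle (d e : nat) (s : 'S_d) : Prop :=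
  exists2 x : 'I_d, #|porbit s x| = e & perm_on (porbit s x) s.

Definition hurwitz_group (d r : nat) (sigma : r.-tuple 'S_d) : {group 'S_d} :=
  <<[set:: sigma]>>%G.

(* The genus does not appear: genus 0 is the numerical condition
   2d - 2 = \sum_i (e_i - 1), which is not part of this definition. *)
Definition hurwitz_factorization (d r : nat) (e : r.-tuple nat)
    (sigma : r.-tuple 'S_d) : Prop :=
  [/\ forall i : 'I_r, is_ecycle (tnth e i) (tnth sigma i),
      \prod_(i < r) tnth sigma i = 1
    & [transitive hurwitz_group sigma, on [set: 'I_d] | 'P]].

(* Main.v *)
(* For r >= 3 a block system of G would give block permutations that again
   multiply to 1, and comparing the Riemann-Hurwitz inequality for blocks with
   the genus 0 equality for points rules it out, so G is primitive. A primitive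
   group of degree d containing an m-cycle, 1 < m < d, is (d - m + 1)-transitive
   (Jordan, Marggraf), and a sufficiently transitive group can move the support
   of an element t so that it meets the old one in a single point; the
   commutator of t with its conjugate is then a 3-cycle, and a primitive group
   with a 3-cycle contains the alternating group. If r >= 4, the shortest
   sigma_i serves as t. If r = 3, exactly one point o is moved by all three
   cycles, sigma_1 = (o C A) and sigma_2 = (o A^-1 B), which makes the
   factorization unique up to conjugation and shows that [sigma_1, sigma_2]
   moves at most four points; it serves as t except in a few small cases, of
   which only (4, 4, 5) is a true exception. There G permutes the five colours
   of a one-factorization of K_6. For r >= 4 and G = A_d at most one sigma_i has
   fewer than two fixed points, so one choice of tau fixes the sign of all the
   conjugating elements. *)

Require Import Defs.
From mathcomp Require Import zify.

Set Implicit Arguments.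
Unset Strict Implicit.
Unset Printing Implicit Defensive.

Local Open Scope group_scope.

(* [lia] after discarding the hypotheses that are not about [nat]; otherwise
   the preprocessing of set-theoretic hypotheses makes it very slow. *)
Ltac is_arith P :=
  lazymatch P with
  | is_true (leq _ _) => idtac
  | is_true (andb (leq _ _) (leq _ _)) => idtac
  | @eq nat _ _ => idtac
  | not (@eq nat _ _) => idtac
  | is_true (negb (leq _ _)) => idtac
  | is_true (@eq_op ?T _ _) => unify (Equality.sort T) nat
  | is_true (negb (@eq_op ?T _ _)) => unify (Equality.sort T) nat
  end.
Ltac arith :=
  intros; repeat match goal with H : ?P |- _ => is_arith P; revert H end;
  repeat match goal with |- context [card ?A] => let n := fresh "n" in set n :=
    (card A); clearbody n end;
  clear; lia.

(** * Jordan sets and cycles in primitive groups *)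

(** The transitivity theorem grows sets [X] such that the elements of [G] fixing [S :\: X] pointwise
    are transitive on [X]. The support of a cycle is such a set; so are its translates under [G],
    and the union of two such sets that meet. Primitivity lets the growth reach the complement of a
    point, which gives 2-transitivity. Going on through point stabilisers needs a property that they
    inherit, and primitivity alone does not descend; the induction therefore carries 2-transitivity,
    and growth has to reach the complement of two points. What can stop it is an invariant linear
    space whose lines have more than two points, and no cycle with a whole line of fixed points
    preserves one. A subset [S] is carried along because stabilisers act on fewer points of the same
    type.

    Conjugacy inside [G] is settled in two unrelated ways: for three cycles one permutation
    conjugates the whole triple, which also covers (4, 4, 5); for four or more the cycles are
    treated one at a time, once [G] is known to contain the alternating group. *)

Definition cycle_on (T : finType) (D : {set T}) (g : {perm T}) :=
  perm_on D g /\ {in D, forall x, porbit g x = D}.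

Definition jordan_set (T : finType) (G : {set {perm T}}) (S X : {set T}) :=
  forall x y, x \in X -> y \in X ->
    exists2 h : {perm T}, h \in G & h x = y /\ {in S :\: X, forall z, h z = z}.

Section JordanSets.

Variables (T : finType) (G : {group {perm T}}) (S : {set T}).
Hypothesis actS : [acts G, on S | 'P].

Lemma acts_in h z : h \in G -> (h z \in S) = (z \in S).
Proof. by move=> Gh; exact: (actsP actS h Gh z). Qed.

(** Every point of the union is reached from the common point [z] inside [X] or inside [Y], and an
    element fixing [S :\: X] or [S :\: Y] fixes the smaller set [S :\: (X :|: Y)]. *)
Lemma jordan_setU (X Y : {set T}) z :
  z \in X -> z \in Y -> jordan_set G S X -> jordan_set G S Y ->
  jordan_set G S (X :|: Y).
Proof.
move=> Xz Yz jX jY.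
suff from_z x : x \in X :|: Y ->
    exists2 h, h \in G & h z = x /\ {in S :\: (X :|: Y), forall w, h w = w}.
  move=> x y /from_z[h Gh [hz fh]] /from_z[k Gk [kz fk]].
  exists (h^-1 * k); first by rewrite groupM ?groupV.
  split=> [|w Sw]; first by rewrite permM -hz permK.
  by rewrite permM -{1}(fh _ Sw) permK fk.
case/setUP=> [Xx | Yx].
  have [h Gh [hz fh]] := jX z x Xz Xx; exists h => //; split=> // w.
  by rewrite !inE negb_or -andbA => /and3P[nX _ Sw]; apply: fh; rewrite inE nX.
have [h Gh [hz fh]] := jY z x Yz Yx; exists h => //; split=> // w.
by rewrite !inE negb_or -andbA => /and3P[_ nY Sw]; apply: fh; rewrite inE nY.
Qed.

Lemma mem_imset_perm (h : {perm T}) (X : {set T}) z :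
  (h z \in h @: X) = (z \in X).
Proof. by rewrite mem_imset //; apply: perm_inj. Qed.

Lemma mem_imset_permV (h : {perm T}) (X : {set T}) z :
  (z \in h @: X) = (h^-1 z \in X).
Proof. by rewrite -{1}(permKV h z) mem_imset_perm. Qed.

Lemma jordan_setJ h (X : {set T}) :
  h \in G -> jordan_set G S X -> jordan_set G S (h @: X).
Proof.
move=> Gh jX _ _ /imsetP[x Xx ->] /imsetP[y Xy ->].
have [k Gk [kx fk]] := jX x y Xx Xy.
exists (k ^ h); first by rewrite groupJ.
split=> [|z]; first by rewrite permJ kx.
rewrite inE mem_imset_permV => /andP[nXz Sz].
rewrite -{1}(permKV h z) permJ fk ?permKV //.
by rewrite inE nXz acts_in ?groupV.
Qed.

Lemma imset_actS h (X : {set T}) : h \in G -> X \subset S -> h @: X \subset S.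
Proof.
move=> Gh /subsetP sXS; apply/subsetP=> _ /imsetP[x Xx ->].
by rewrite acts_in ?sXS.
Qed.

Lemma imset_permD (h : {perm T}) (X : {set T}) : h \in G -> X \subset S ->
  h @: (S :\: X) = S :\: h @: X.
Proof.
move=> Gh sXS; apply/setP=> z.
by rewrite mem_imset_permV !inE -mem_imset_permV acts_in ?groupV.
Qed.

Lemma card_imset_perm (h : {perm T}) (X : {set T}) : #|h @: X| = #|X|.
Proof. by apply: card_imset; apply: perm_inj. Qed.

(** Otherwise [Z] is a block, and its setwise stabiliser lies strictly between a point stabiliser
    and [G], against the maximality of the former. *)
Lemma primitive_no_block (Z : {set T}) :
    [primitive G, on S | 'P] -> Z \subset S -> 1 < #|Z| < #|S| ->
  exists2 h : {perm T}, h \in G & (h @: Z != Z) && (h @: Z :&: Z != set0).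
Proof.
move=> primG sZS /andP[/card_gt1P[x [y [Zx Zy neq_xy]]] ltZS].
have Sx := subsetP sZS x Zx; have [trG _] := andP primG.
case: (boolP [exists h in G, (h @: Z != Z) && (h @: Z :&: Z != set0)]).
  by case/exists_inP=> h; exists h.
move/exists_inPn=> noh.
have blk h z : h \in G -> z \in Z -> h z \in Z -> h @: Z = Z.
  move=> Gh Zz Zhz; have := noh h Gh; rewrite negb_and !negbK => /orP[/eqP//|].
  by move/eqP/setP/(_ (h z)); rewrite !inE mem_imset_perm Zz Zhz.
have NZ (h : {perm T}) : (h \in 'N(Z | 'P)) = (h @: Z == Z).
  rewrite -astab1_set; apply/idP/eqP => [/astab1P|] //= eqZ.
  by apply/astab1P.
move: (primG); rewrite (trans_prim_astab Sx trG) => /maximal_eqP[_].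
case/(_ ('N_G(Z | 'P))%G) => /= [|||defN].
- apply/subsetP=> h /setIP[Gh /astab1P fh]; rewrite inE Gh NZ.
  have hx : h x = x := fh.
  by rewrite (blk h x Gh Zx) ?hx ?eqxx.
- by apply/subsetP=> h /setIP[].
- move=> defN; have [h Gh hx] := atransP2 trG Sx (subsetP sZS y Zy).
  have: h \in 'N_G(Z | 'P).
    have hxy : h x = y := esym hx.
    by rewrite inE Gh NZ (blk h x) ?hxy ?eqxx.
  rewrite defN => /setIP[_ /astab1P fh].
  by rewrite hx /= fh eqxx in neq_xy.
move: ltZS; rewrite ltnNge => /negP[]; apply/subset_leq_card/subsetP=> z Sz.
have [h Gh ->] := atransP2 trG Sx Sz.
have: h \in 'N_G(Z | 'P) by rewrite defN.
by case/setIP=> _; rewrite NZ => /eqP <-; apply: imset_f.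
Qed.

Lemma primitive_jordanD1 (D : {set T}) a :
    [primitive G, on S | 'P] -> D \subset S -> 1 < #|D| < #|S| ->
    jordan_set G S D -> a \in S ->
  jordan_set G S (S :\ a).
Proof.
move=> primG sDS /andP[lt1D ltDS] jD Sa; have [trG _] := andP primG.
(* Only the size matters: transitivity moves the one missing point to [a]. *)
suff [X [sXS oX jX]] :
    exists X : {set T}, [/\ X \subset S, #|X| = #|S|.-1 & jordan_set G S X].
  have: #|S :\: X| == 1%N.
    rewrite cardsD (setIidPr sXS) oX; arith.
  case/cards1P=> b defb.
  have Sb: b \in S.
    by have: b \in S :\: X; [rewrite defb set11 | rewrite inE => /andP[]].
  have defX: X = S :\ b by rewrite -defb setDDr setDv set0U (setIidPr sXS).
  have [h Gh hb] := atransP2 trG Sb Sa.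
  have := jordan_setJ Gh jX; rewrite defX imset_permD ?sub1set //.
  by rewrite imset_set1; have <- : a = h b := hb.
move: {2}(#|S| - #|D|) (leqnn (#|S| - #|D|)) => n.
elim: n => [|n IHn] in D sDS lt1D ltDS jD *; first by move=> ?; arith.
move=> leDn; have [eqD | neqD] := eqVneq #|D| #|S|.-1; first by exists D.
suff [h Gh /and3P[neqh meeth nSh]] :
    exists2 h : {perm T}, h \in G &
      [&& h @: D != D, h @: D :&: D != set0 & h @: D :|: D != S].
  have [z] := set0Pn _ meeth; rewrite inE => /andP[hDz Dz].
  have sU: h @: D :|: D \subset S by rewrite subUset imset_actS.
  have ltD: #|D| < #|h @: D :|: D|.
    apply: proper_card; rewrite properE subsetUr /= subUset subxx andbT.
    by apply: contra neqh => sub; rewrite eqEcard sub card_imset_perm leqnn.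
  apply: IHn (sU) _ _ _ _.
  - exact: ltn_trans lt1D ltD.
  - by rewrite ltn_neqAle subset_leq_card // andbT; apply: contraNneq nSh => e;
       rewrite eqEcard sU e leqnn.
  - exact: (jordan_setU hDz Dz) (jordan_setJ Gh jD) jD.
  - by arith.
(* A translate must meet [D] without covering the rest of [S]. Below half the size of [S] covering
   is impossible by counting; from half the size on, [primitive_no_block] is applied to the
   complement, which prevents covering, and disjointness is impossible by counting. *)
have [ltDS2 | geDS2] := ltnP (2 * #|D|)%N #|S|.
  have [|h Gh /andP[neqh meeth]] := primitive_no_block primG sDS.
    by rewrite lt1D.
  exists h; rewrite // neqh meeth; apply: contraTneq ltDS2 => <-.
  rewrite -leqNgt; have [+ _] := leq_card_setU (h @: D) D.
  by rewrite card_imset_perm; arith.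
have [||h Gh /andP[]] := @primitive_no_block (S :\: D) primG.
- exact: subsetDl.
- by rewrite cardsD (setIidPr sDS); arith.
rewrite imset_permD // => neqh meeth; exists h => //.
have neqS: h @: D :|: D != S.
  apply: contraNneq meeth => eqS; apply/eqP/setP=> z.
  have inS : (z \in S) = (z \in h @: D) || (z \in D) by rewrite -eqS inE.
  by rewrite !inE inS; case: (z \in D) => //=; case: (z \in h @: D).
rewrite neqS (contraNneq _ neqh) => [|-> //] /=; rewrite andbT.
apply: contraNneq neqS => dis.
rewrite eqEcard subUset imset_actS //= sDS cardsU dis cards0 card_imset_perm.
by arith.
Qed.

End JordanSets.

(* The lines joining a moved point [x] to two fixed points both meet [D] in the
   orbit of [x] under the subgroup of order k - 1 of the cyclic group <[g]>, so
   they coincide. *)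
Lemma no_linear_space (T : finType) (S D Y : {set T}) (L : {set {set T}})
    (k : nat) (g : {perm T}) :
    cycle_on D g -> 1 < #|D| -> D \subset S ->
    (forall A B x y, A \in L -> B \in L -> x != y ->
       x \in A -> y \in A -> x \in B -> y \in B -> A = B) ->
    {in S &, forall x y, x != y -> exists2 A, A \in L & (x \in A) && (y \in A)} ->
    {in L, forall A : {set T}, g @: A \in L} ->
    {in L, forall A : {set T}, #|A| = k} -> 2 < k ->
    Y \in L -> Y \subset S -> [disjoint Y & D] -> False.
Proof.
move=> [onD orbD] lt1D sDS uniqL exL gL cardL lt2k LY sYS disYD.
have fixD z : z \notin D -> g z = z by apply: out_perm.
have fixY z : z \in Y -> z \notin D by move=> Yz; rewrite (disjointFr disYD Yz).
have fixX i z : z \notin D -> (g ^+ i) z = z by move=> /fixD; apply: permX_fix.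
have gLX i A : A \in L -> (g ^+ i) @: A \in L.
  move=> LA; elim: i => [|i IHi].
    by rewrite expg0 imset_perm1.
  suff -> : (g ^+ i.+1) @: A = g @: ((g ^+ i) @: A) by apply: gL.
  by rewrite -imset_comp; apply: eq_imset => z; rewrite expgSr permM.
have fullD A u v x : A \in L -> u != v -> u \in A -> v \in A ->
    u \notin D -> v \notin D -> x \in A -> x \in D -> D \subset A.
  move=> LA neq Au Av nDu nDv Ax Dx; apply/subsetP=> z.
  rewrite -(orbD x Dx) => /porbitP[i ->].
  have <- : (g ^+ i) @: A = A.
    apply: (uniqL _ _ u v (gLX i A LA) LA) => //.
      by rewrite -(fixX i u) ?mem_imset_perm.
    by rewrite -(fixX i v) ?mem_imset_perm.
  by rewrite mem_imset_perm.
(* At most one line contains [D], and it meets [Y] in at most one point; as [k > 2], two points of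
   [Y] remain off it. *)
have [f [f' [neqf [Yf Yf' goodf]]]] : exists f f', f != f' /\
    [/\ f \in Y, f' \in Y & {in L, forall A :
      {set T}, D \subset A -> (f \notin A) && (f' \notin A)}].
  have [A0 /andP[LA0 DA0] | noA] := pickP [pred A | (A \in L) && (D \subset A)];
    last first.
    have /card_gt1P[f [f' [Yf Yf' neq]]] : 1 < #|Y| by rewrite (cardL _ LY);
      arith.
    by exists f, f'; do !split=> //; move=> A LA DA; have := noA A;
      rewrite /= LA DA.
  have [x [y [Dx Dy neqxy]]] := card_gt1P lt1D.
  have le1 : #|Y :&: A0| <= 1.
    rewrite leqNgt; apply/negP=> /card_gt1P[u [v []]].
    rewrite !inE => /andP[Yu Au] /andP[Yv Av] neq.
    have eqY := uniqL _ _ _ _ LY LA0 neq Yu Yv Au Av.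
    by have := fixY x; rewrite eqY Dx (subsetP DA0) // => /(_ isT).
  have /card_gt1P[f [f' []]] : 1 < #|Y :\: A0|.
    by have := cardsID A0 Y; rewrite (cardL _ LY); arith.
  rewrite !inE => /andP[Af Yf] /andP[Af' Yf'] neq; exists f, f'; do !split=> //.
  move=> A LA DA; suff -> : A = A0 by rewrite Af.
  by apply: (uniqL _ _ x y LA LA0); rewrite ?(subsetP DA) ?(subsetP DA0).
have [x Dx] : exists x, x \in D by apply/card_gt0P; arith.
have neqDY z w : z \in D -> w \in Y -> z != w.
  by move=> Dz /fixY; apply: contraNneq => <-.
pose stab (A : {set T}) := 'N_(<[g]>)(A | 'P)%G.
have line fo : fo \in Y ->
  {in L, forall A : {set T}, D \subset A -> fo \notin A} ->
    exists A, [/\ A \in L, x \in A, fo \in A & #|stab A| = k.-1 /\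
      orbit 'P (stab A) x = A :\ fo].
  move=> Yfo goodfo; have Sfo := subsetP sYS _ Yfo; have Sx := subsetP sDS _ Dx.
  have [A LA /andP[Ax Afo]] := exL x fo Sx Sfo (neqDY _ _ Dx Yfo).
  have subD z : z \in A -> z != fo -> z \in D.
    move=> Az neqz; apply/negPn/negP => nDz.
    by have := goodfo A LA (fullD A z fo x LA neqz Az Afo nDz (fixY _ Yfo) Ax Dx);
       rewrite Afo.
  have orbA : orbit 'P (stab A) x = A :\ fo.
    apply/setP=> z; rewrite 2!inE; apply/imsetP/andP.
      case=> h; rewrite /stab inE => /andP[/cycleP[i ->] /astabsP NA] ->.
      split; last by rewrite NA.
      apply: contraNneq (fixY _ Yfo) => /= eqfo.
      have : (g ^+ i) x = (g ^+ i) fo by rewrite (fixX i fo) ?fixY.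
      by move/perm_inj <-.
    case=> neqz Az; have := subD z Az neqz; rewrite -(orbD x Dx).
    case/porbitP=> i defz; exists (g ^+ i) => //.
    rewrite inE mem_cycle /= -astab1_set; apply/astab1P.
    apply: (uniqL _ _ fo z (gLX i A LA) LA); rewrite // 1?eq_sym //.
      by rewrite -(fixX i fo) ?fixY // imset_f.
    by rewrite defz imset_f.
  exists A; split=> //; split=> //.
  have := card_orbit_stab 'P (stab A) x; rewrite orbA.
  (* The cyclic group is abelian and transitive on [D], so an element fixing [x] is trivial; hence
     [stab A] has as many elements as the orbit [A :\ fo]. *)
  have -> : 'C_(stab A)[x | 'P] = 1.
    apply/trivgP/subsetP=> h /setIP[/setIP[/cycleP[i ->] _] /astab1P fx].
    rewrite inE; apply/eqP/permP=> z; rewrite perm1.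
    have [Dz | nDz] := boolP (z \in D); last exact: fixX.
    move: Dz; rewrite -(orbD x Dx) => /porbitP[j ->].
    by rewrite -permM -expgD addnC expgD permM [(g ^+ i) x]fx.
  by rewrite cards1 muln1 => <-; rewrite -(cardL _ LA) (cardsD1 fo A) Afo.
have [A1 [LA1 Ax1 Af1 [oA1 orb1]]] :=
  line f Yf (fun A LA DA => proj1 (andP (goodf A LA DA))).
have [A2 [LA2 Ax2 Af2 [oA2 orb2]]] :=
  line f' Yf' (fun A LA DA => proj2 (andP (goodf A LA DA))).
have eq_stab : stab A1 = stab A2 :> {set _}.
  apply/eqP; rewrite (eq_subG_cyclic (cycle_cyclic g)) ?oA1 ?oA2 //.
    by apply/subsetP=> h /setIP[].
  by apply/subsetP=> h /setIP[].
have eqD : A1 :\ f = A2 :\ f' by rewrite -orb1 -orb2 eq_stab.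
have /card_gt1P[u [v []]] : 1 < #|A1 :\ f|.
  by rewrite -ltnS -[#|_|.+1]add1n; have := cardsD1 f A1;
    rewrite Af1 (cardL _ LA1) => <-.
move=> Au Av neq; have := Au; have := Av;
  rewrite eqD => /setD1P[_ A2v] /setD1P[_ A2u].
have /setD1P[_ A1u] := Au; have /setD1P[_ A1v] := Av.
have eqA := uniqL _ _ _ _ LA1 LA2 neq A1u A1v A2u A2v.
rewrite -eqA in Af2.
have := goodf A1 LA1 (fullD A1 f f' x LA1 neqf Af1 Af2 (fixY _ Yf) (fixY _ Yf')
  Ax1 Dx).
by rewrite Af1.
Qed.

Lemma cycle_on_jordan (T : finType) (G : {group {perm T}}) (S D : {set T}) g :
  g \in G -> cycle_on D g -> jordan_set G S D.
Proof.
move=> Gg [onD orbD] x y Dx; rewrite -(orbD x Dx) => /porbitP[i ->].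
exists (g ^+ i); [exact: groupX | split=> // z].
by rewrite inE orbD // => /andP[/(out_perm onD) fz _]; apply: permX_fix.
Qed.

Lemma trans2P (T : finType) (G : {group {perm T}}) (S : {set T}) x y x' y' :
    [transitive^2 G, on S | 'P] -> x \in S -> y \in S -> x != y ->
    x' \in S -> y' \in S -> x' != y' ->
  exists2 h : {perm T}, h \in G & h x = x' /\ h y = y'.
Proof.
move=> tr2 Sx Sy neq Sx' Sy' neq'.
have dS u v : u \in S -> v \in S -> u != v -> [tuple u; v] \in 2.-dtuple(S).
  by move=> Su Sv neq_uv; rewrite inE memtE subset_all /= mem_seq1 neq_uv Su Sv.
have [h Gh /(congr1 val)/= [-> ->]] :=
  atransP2 tr2 (dS x y Sx Sy neq) (dS x' y' Sx' Sy' neq').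
by exists h.
Qed.

(* The complements of the translates of a maximal Jordan set with at most
   |S| - 2 points meet pairwise in at most one point: they are the lines of a
   linear space. *)
Lemma trans2_jordanD2 (T : finType) (G : {group {perm T}}) (S D : {set T}) g a b :
    [acts G, on S | 'P] -> [transitive^2 G, on S | 'P] ->
    g \in G -> cycle_on D g -> D \subset S -> 1 < #|D| -> #|D|.+1 < #|S| ->
    a \in S -> b \in S -> a != b ->
  jordan_set G S (S :\: [set a; b]).
Proof.
move=> actS tr2 Gg cycD sDS lt1D ltDS Sa Sb neqab.
suff [X [sXS oX jX]] :
    exists X : {set T}, [/\ X \subset S, #|X| = #|S|.-2 & jordan_set G S X].
  have: #|S :\: X| == 2 by rewrite cardsDS // oX; arith.
  case/cards2P=> u [v [neq_uv defuv]].
  have: u \in S :\: X by rewrite defuv !inE eqxx.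
  have: v \in S :\: X by rewrite defuv !inE eqxx orbT.
  rewrite !inE => /andP[_ Sv] /andP[_ Su].
  have defX: X = S :\: [set u; v]
    by rewrite -defuv setDDr setDv set0U (setIidPr sXS).
  have [h Gh [hu hv]] := trans2P tr2 Su Sv neq_uv Sa Sb neqab.
  have := jordan_setJ actS Gh jX; rewrite defX (imset_permD actS) //.
    by rewrite imsetU !imset_set1 hu hv.
  by rewrite -defuv subsetDl.
have jD0 := cycle_on_jordan S Gg cycD.
suff step n (X : {set T}) :
  D \subset X -> X \subset S -> #|X|.+1 < #|S| -> #|S| - #|X| <= n ->
    jordan_set G S X ->
    exists X : {set T}, [/\ X \subset S, #|X| = #|S|.-2 & jordan_set G S X].
  exact: (step #|S| D (subxx D) sDS ltDS (leq_subr _ _) jD0).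
elim: n X => [|n IHn] X sDX sXS ltXS leX jX; first by arith.
have [eqX | neqX] := eqVneq #|X| #|S|.-2; first by exists X.
case: (boolP [exists h in G, [&& h @: X != X, h @: X :&: X != set0
                               & #|h @: X :|: X|.+1 < #|S|]]).
  case/exists_inP=> h Gh /and3P[neqh meeth ltU].
  have [z] := set0Pn _ meeth; rewrite inE => /andP[hXz Xz].
  have sU: h @: X :|: X \subset S by rewrite subUset (imset_actS actS).
  have ltX: #|X| < #|h @: X :|: X|.
    apply: proper_card; rewrite properE subsetUr /= subUset subxx andbT.
    by apply: contra neqh => sub; rewrite eqEcard sub card_imset_perm leqnn.
  apply: (IHn _ _ sU ltU).
  - exact: subset_trans sDX (subsetUr _ _).
  - by arith.
  - exact: (jordan_setU hXz Xz) (jordan_setJ actS Gh jX) jX.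
move/exists_inPn=> noh; exfalso.
have lt1X : 1 < #|X| := leq_trans lt1D (subset_leq_card sDX).
(* Below half the size of [S], 2-transitivity gives a translate that shares [x] with [X] and also
   leaves [X]; the union has at most [2 * #|X| - 1] points, so growth would not have stopped. *)
have [ltXS2 | geXS2] := ltnP (2 * #|X|)%N #|S|.
  have [x [y [Xx Xy neq]]] := card_gt1P lt1X.
  have [z /setDP[Sz nXz]] : exists z, z \in S :\: X.
    by apply/card_gt0P; rewrite cardsDS //; arith.
  have neqxz : x != z by apply: contraNneq nXz => <-.
  have [h Gh [hx hy]] := trans2P tr2 (subsetP sXS x Xx) (subsetP sXS y Xy) neq
                           (subsetP sXS x Xx) Sz neqxz.
  have hXX : x \in h @: X by rewrite -{1}hx mem_imset_perm.
  have := noh h Gh; rewrite !negb_and !negbK => /or3P[/eqP eqX|/eqP eq0|].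
  - by move: nXz; rewrite -eqX -hy mem_imset_perm Xy.
  - by have := in_set0 x; rewrite -eq0 inE hXX Xx.
  have : 0 < #|h @: X :&: X| by apply/card_gt0P; exists x; rewrite inE hXX.
  by have := cardsUI (h @: X) X; rewrite card_imset_perm; arith.
set Y := S :\: X; pose L := [set (fun x => h x) @: Y | h : {perm T} in G].
have oY : #|Y| = (#|S| - #|X|)%N by rewrite cardsDS.
(* If two points of [Y] lie in its translate, the union of the corresponding translates of [X]
   misses two points. As [X] cannot grow, these coincide or are disjoint, and disjoint ones would
   cover [S] because [2 * #|X| >= #|S|]. *)
have YY h : h \in G -> 1 < #|h @: Y :&: Y| -> h @: Y = Y.
  move=> Gh lt1; have := noh h Gh.
  rewrite !negb_and !negbK => /or3P[/eqP eqX|/eqP eq0|].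
  - by rewrite /Y (imset_permD actS) ?eqX.
  - have : #|h @: Y :&: Y| = 0%N.
      apply/eqP; rewrite cards_eq0; apply/eqP/setP=> z.
      have sU: h @: X :|: X \subset S by rewrite subUset (imset_actS actS).
      have eqS : h @: X :|: X = S.
        by apply/eqP; rewrite eqEcard sU cardsU eq0 cards0 card_imset_perm; arith.
      rewrite /Y (imset_permD actS) // -eqS !inE.
      by case: (z \in X) => //=; case: (z \in h @: X).
    by move: lt1 => /[swap] ->.
  have eqI : h @: Y :&: Y = S :\: (h @: X :|: X).
    by rewrite /Y (imset_permD actS) // setDUr.
  move: lt1; rewrite eqI cardsDS ?subUset ?(imset_actS actS) //.
  arith.
have sLS A : A \in L -> A \subset S.
  by case/imsetP=> h Gh ->; rewrite (imset_actS actS) ?subsetDl.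
apply: (@no_linear_space T S D Y L #|Y| g) => //.
- move=> _ _ x y /imsetP[h Gh ->] /imsetP[k Gk ->] neq hx hy kx ky.
  have GM : h * k^-1 \in G by rewrite groupM ?groupV.
  have imM : [set (h * k^-1) z | z in Y] = k^-1 @: (h @: Y).
    by rewrite -imset_comp; apply: eq_imset => z; rewrite permM.
  have : k @: (k^-1 @: (h @: Y)) = k @: Y.
    rewrite -imM YY // imM; apply/card_gt1P; exists (k^-1 x), (k^-1 y).
    by rewrite !in_setI !mem_imset_perm hx hy -!mem_imset_permV kx ky
      (inj_eq perm_inj).
  by rewrite -imset_comp (eq_imset (g := id)) ?imset_id // => z /=;
    rewrite permKV.
- move=> x y Sx Sy neq; have /card_gt1P[u [v [Yu Yv neq']]] : 1 < #|Y|.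
    by rewrite oY; arith.
  have sYS : Y \subset S by apply: subsetDl.
  have [h Gh [hu hv]] := trans2P tr2 (subsetP sYS u Yu) (subsetP sYS v Yv) neq'
    Sx Sy neq.
  exists (h @: Y); first by apply/imsetP; exists h.
  by rewrite -hu -hv !mem_imset_perm Yu.
- move=> _ /imsetP[h Gh ->]; apply/imsetP; exists (h * g);
  first by rewrite groupM.
  by rewrite -imset_comp; apply: eq_imset => z; rewrite permM.
- by move=> _ /imsetP[h Gh ->]; rewrite card_imset_perm.
- by rewrite oY; arith.
- by apply/imsetP; exists 1; rewrite ?group1 // imset_perm1.
- exact: subsetDl.
by rewrite disjoint_sym disjoints_subset; apply: (subset_trans sDX);
  rewrite /Y setCD subsetUr.
Qed.

Lemma jordan_set_trans (T : finType) (G H : {group {perm T}}) (S X : {set T}) x :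
    [acts G, on S | 'P] -> X \subset S -> jordan_set G S X -> x \in X ->
    (forall h, h \in H <-> h \in G /\ {in S :\: X, forall z, h z = z}) ->
  [transitive H, on X | 'P].
Proof.
move=> actS sXS jX Xx memH; apply/imsetP; exists x => //; apply/setP=> y.
apply/idP/imsetP => [Xy | [h Hh ->]].
  by have [h Gh [hx fh]] := jX x y Xx Xy; exists h => //; apply/memH.
have [Gh fh] := (memH h).1 Hh; have Sx := subsetP sXS x Xx.
apply/negPn/negP=> nXhx; have Dhx : h x \in S :\: X.
  by rewrite inE nXhx (acts_in actS).
by have := perm_inj (fh _ Dhx) => eqx; case/negP: nXhx; rewrite /= apermE eqx.
Qed.

(** Induction on [#|S|]: for [a] outside [D], the stabiliser of [a] contains [g] and is again
    2-transitive on [S :\ a], because [trans2_jordanD2] makes the stabiliser of two points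
    transitive on the others. The induction ends when [g] has a single fixed point. *)
Theorem trans2_cycle_ntrans (T : finType) (G : {group {perm T}}) (S D : {set T})
  g :
    [transitive^2 G, on S | 'P] -> g \in G -> cycle_on D g -> D \subset S ->
    1 < #|D| < #|S| ->
  [transitive^(#|S| - #|D|).+1 G, on S | 'P].
Proof.
move=> + + cycD + /andP[lt1D]; have [n] := ubnP #|S|.
elim: n G S => // n IHn G S lenS tr2 Gg sDS ltDS.
have trG : [transitive G, on S | 'P] := ntransitive1 (isT : 0 < 2) tr2.
have actS := atrans_acts trG.
have [eqS | neqS] := eqVneq #|S| #|D|.+1; first by rewrite eqS subSnn.
have ltDS1 : #|D|.+1 < #|S| by rewrite ltn_neqAle eq_sym neqS.
have [a /setDP[Sa nDa]] : exists a, a \in S :\: D.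
  by apply/card_gt0P; rewrite cardsDS // subn_gt0.
have fixDa h : h \in <[g]> -> forall z, z \notin D -> h z = z.
  by case/cycleP=> i -> z nDz; apply: permX_fix; apply: out_perm (proj1 cycD) nDz.
have oSa : #|S :\ a| = #|S|.-1 by rewrite [in RHS](cardsD1 a S) Sa.
apply: (@stab_ntransitiveI _ _ _ _ _ _ a) => //.
have -> : (#|S| - #|D|)%N = (#|S :\ a| - #|D|).+1 by rewrite oSa; arith.
have trGa : [transitive 'C_G[a | 'P], on S :\ a | 'P].
  by apply: (@ntransitive1 _ _ _ _ _ 1) => //; apply: stab_ntransitive.
have actSa := atrans_acts trGa.
have sDSa : D \subset S :\ a by rewrite subsetD1 sDS.
have ltDSa : #|D| < #|S :\ a| by rewrite oSa; arith.
apply: (IHn 'C_G[a | 'P]%G) => //; first by rewrite oSa; arith.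
  have [b Sab] : exists b, b \in S :\ a by apply/card_gt0P; arith.
  have /setD1P[neqba Sb] := Sab.
  apply: (@stab_ntransitiveI _ _ _ _ _ _ b) => //.
  have [c Xc] : exists c, c \in S :\ a :\ b.
    by apply/card_gt0P; have := cardsD1 b (S :\ a); rewrite Sab oSa; arith.
  apply: (@stab_ntransitiveI _ _ _ _ _ _ c) => //; last exact: ntransitive0.
  have jX := trans2_jordanD2 actS tr2 Gg cycD sDS lt1D ltDS1 Sa Sb.
  rewrite eq_sym neqba in jX; have {jX} := jX isT;
    rewrite setUC -setDDl setDDl setUC -setDDl => jX.
  apply: (jordan_set_trans actS _ jX Xc);
    first by rewrite subDset subsetU // subsetDl orbT.
  move=> h; split.
    case/setIP=> /setIP[Gh /astab1P fa] /astab1P fb; split=> // z; rewrite !inE.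
    have [-> | neqzb] := eqVneq z b; first by move=> _; exact: fb.
    have [-> | neqza] := eqVneq z a; first by move=> _; exact: fa.
    by rewrite /= andNb.
  case=> Gh fh; rewrite !inE Gh; apply/andP; split; rewrite sub1set inE;
    apply/eqP; apply: fh.
    by rewrite !inE eqxx Sa andbF.
  by rewrite !inE eqxx Sb.
rewrite inE Gg; apply/astab1P; apply: out_perm (proj1 cycD) nDa.
Qed.

Theorem primitive_cycle_ntrans (T : finType) (G : {group {perm T}})
  (S D : {set T}) g :
    [primitive G, on S | 'P] -> g \in G -> cycle_on D g -> D \subset S ->
    1 < #|D| < #|S| ->
  [transitive^(#|S| - #|D|).+1 G, on S | 'P].
Proof.
move=> primG Gg cycD sDS ltD; apply: (trans2_cycle_ntrans _ Gg cycD sDS ltD).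
have [trG _] := andP primG; have actS := atrans_acts trG.
have [a Sa] : exists a, a \in S by apply/card_gt0P; arith.
have [b Sb] : exists b, b \in S :\ a.
  by apply/card_gt0P; have := cardsD1 a S; rewrite Sa; arith.
apply: (@stab_ntransitiveI _ _ _ _ _ _ a) => //.
apply: (@stab_ntransitiveI _ _ _ _ _ _ b) => //; last exact: ntransitive0.
have jX := primitive_jordanD1 actS primG sDS ltD (cycle_on_jordan S Gg cycD) Sa.
apply: (jordan_set_trans actS _ jX Sb); first exact: subsetDl.
move=> h; split.
  case/setIP=> Gh /astab1P fa; split=> // z; rewrite !inE.
  have [-> | neqza] := eqVneq z a; first by move=> _; exact: fa.
  by rewrite /= andNb.
case=> Gh fh; rewrite !inE Gh sub1set inE; apply/eqP; apply: fh.
by rewrite !inE eqxx Sa.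
Qed.

(** * The Riemann-Hurwitz inequality and primitivity *)

Lemma card_porbits_le (T : finType) (p : {perm T}) : #|porbits p| <= #|T|.
Proof. exact: leq_imset_card. Qed.

Lemma card_porbits1 (T : finType) : #|porbits (1 : {perm T})| = #|T|.
Proof.
apply: card_imset => x y /eqP; rewrite eq_porbit_mem => /porbitP[i ->].
by rewrite expg1n perm1.
Qed.

Lemma perm_neq1 (T : finType) (p : {perm T}) : p != 1 -> exists x, p x != x.
Proof.
move=> neq1; apply/existsP; apply: contraNT neq1 => /existsPn fixp.
by apply/eqP/permP=> x; rewrite perm1; apply/eqP/negPn/fixp.
Qed.

(** Multiplying by [tperm x (p x)] cuts [x] off its cycle, so every transposition used raises the
    number of orbits by one. *)
Lemma prod_tperm_min (T : finType) (p : {perm T}) :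
  exists2 ts : seq (T * T), p = \prod_(t <- ts) tperm t.1 t.2
                         & (size ts + #|porbits p| = #|T|)%N.
Proof.
have [n] := ubnP (#|T| - #|porbits p|)%N.
elim: n p => // n IHn p len.
have [-> | /perm_neq1[x px]] := eqVneq p 1.
  by exists [::]; rewrite ?big_nil ?card_porbits1.
have := porbits_mul_tperm p x (p x).
rewrite /= porbit_sym (_ : p x \in porbit p x) /=; last exact: (mem_porbit p 1).
rewrite eq_sym px addn0 addn1.
set q : {perm T} := tperm x (p x) * p => oq.
have lep := card_porbits_le q.
have [|ts defq ots] := IHn q; first by arith.
exists ((x, p x) :: ts); last by rewrite /=; arith.
by rewrite big_cons -defq mulgA tperm2 mul1g.
Qed.

(** With the transpositions as edges of a graph, [f] colours its components. An edge inside one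
    colour adds at most one orbit. An edge between two colours joins two orbits, since [f] is
    constant on the orbits of the product, and merging the two colours loses at most one of them. *)
Lemma prod_tperm_colouring (T : finType) (ts : seq (T * T)) :
  exists2 f : T -> T, {in ts, forall t, f t.1 = f t.2} &
    (#|T| + #|porbits (\prod_(t <- ts) tperm t.1 t.2)%g|
       <= size ts + 2 * #|f @: setT|)%N.
Proof.
elim: ts => [|[x y] ts [f fts le_f]].
  by exists id; rewrite // big_nil card_porbits1 imset_id cardsT /=; arith.
rewrite big_cons; set p := (\prod_(t <- ts) _)%g in le_f *.
have fp z : f (p z) = f z.
  rewrite /p; elim: ts z fts {le_f p} => [|[u v] ts IHts] z fts.
    by rewrite big_nil perm1.
  rewrite big_cons permM IHts => [|t ts_t]; last by apply: fts;
    rewrite inE ts_t orbT.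
  by have := fts (u, v) (mem_head _ _) => /= fuv; case: tpermP => // ->.
have := porbits_mul_tperm p x y; rewrite /=.
set q : {perm T} := (tperm x y * p)%g => oq.
have [fxy | nfxy] := eqVneq (f x) (f y).
  exists f => [t|]; first by rewrite inE => /predU1P[-> | /fts].
  by move: oq; case: (x != y); case: (x \notin _) => /= oq; arith.
pose f' z := if f z == f x then f y else f z.
exists f' => [t|].
  rewrite inE => /predU1P[-> | /fts ft]; last by rewrite /f' ft.
  by rewrite /f' /= eqxx eq_sym (negPf nfxy).
have sub : f @: setT \subset f x |: f' @: setT.
  apply/subsetP=> _ /imsetP[z _ ->]; rewrite !inE.
  by case: eqP => //= /eqP/negPf neq; apply/imsetP; exists z; rewrite /f' ?neq.
have := subset_leq_card sub; rewrite cardsU1.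
move: oq; have -> : x \notin porbit p y.
  apply: contra nfxy => /porbitP[i ->]; apply/eqP.
  by elim: i => [|i <-]; rewrite ?expg0 ?perm1 // expgSr permM fp.
by case: (x != y); case: (f x \notin _) => /=; arith.
Qed.

(* Nonnegativity of the genus; [f] stands for a colouring of the components. *)
Lemma riemann_hurwitz (T : finType) (A : {set T}) (ps : seq {perm T}) :
    \prod_(p <- ps) p = 1 ->
    (forall f : T -> T, (forall (p : {perm T}) x, p \in ps -> f (p x) = f x) ->
       {in A &, forall x y, f x = f y}) ->
  (2 * (#|A| - 1) <= \sum_(p <- ps) (#|T| - #|porbits p|))%N.
Proof.
move=> prod1 connA.
suff [ts [defps ots tsps]] : exists ts : seq (T * T),
    [/\ \prod_(p <- ps) p = \prod_(t <- ts) tperm t.1 t.2,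
        size ts = (\sum_(p <- ps) (#|T| - #|porbits p|))%N &
        forall f : T -> T, {in ts, forall t, f t.1 = f t.2} ->
          forall (p : {perm T}) x, p \in ps -> f (p x) = f x].
  have [f fts] := prod_tperm_colouring ts; rewrite -defps prod1 card_porbits1 ots.
  have [-> | [a Aa]] := set_0Vmem A; first by rewrite cards0.
  (* The set [A] receives a single colour, so at most [1 + #|~: A|] colours occur. *)
  have sub : f @: setT \subset f a |: f @: (~: A).
    apply/subsetP=> _ /imsetP[z _ ->]; rewrite !inE.
    have [Az | nAz] := boolP (z \in A); last by rewrite imset_f ?orbT // inE.
    by rewrite (connA f (tsps f fts) z a) ?eqxx.
  have := subset_leq_card sub; rewrite cardsU1.
  have := leq_imset_card f (~: A); have := cardsC A.
  by case: (_ \notin _) => /=; arith.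
elim: ps {prod1 connA} => [|p ps [ts [defps ots tsps]]].
  by exists [::]; rewrite !big_nil; split.
have [us defp ous] := prod_tperm_min p.
exists (us ++ ts); split=> [||f fts].
- by rewrite big_cons big_cat /= -defp defps.
- by rewrite big_cons size_cat ots; arith.
move=> q x; rewrite inE => /predU1P[-> | ps_q]; last first.
  by apply: tsps ps_q => t ts_t; apply: fts; rewrite mem_cat ts_t orbT.
have fus : {in us, forall t, f t.1 = f t.2}.
  by move=> t us_t; apply: fts; rewrite mem_cat us_t.
rewrite defp; elim: us x fus {ous defp fts} => [|[u v] us IHus] x fus.
  by rewrite big_nil perm1.
rewrite big_cons permM IHus => [|t us_t]; last by apply: fus;
  rewrite inE us_t orbT.
by have := fus (u, v) (mem_head _ _) => /= fuv; case: tpermP => // ->.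
Qed.

Definition psupport (T : finType) (p : {perm T}) := [set x | p x != x].

Lemma card_porbits_cycle (T : finType) (p : {perm T}) x :
    (forall z, z \notin porbit p x -> p z = z) ->
  (#|porbits p| + #|porbit p x| = #|T|.+1)%N.
Proof.
move=> fixp; have -> : #|T| = (#|porbit p x| + #|~: porbit p x|)%N
  by rewrite cardsC.
rewrite addnC -addnS; congr (_ + _)%N.
have -> : #|~: porbit p x|.+1 = #|porbit p @: (x |: ~: porbit p x)|.
  rewrite card_in_imset => [|y z]; first by rewrite cardsU1 inE porbit_id.
  move=> Xy Xz /eqP; rewrite eq_porbit_mem.
  have fixo w : w != x -> w \in x |: ~: porbit p x -> porbit p w = [set w].
    move=> neq; rewrite !inE (negPf neq) /= => /fixp pw; apply/setP=> v.
    rewrite inE; apply/porbitP/eqP => [[i ->] | ->]; first exact: permX_fix.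
    by exists 0%N; rewrite expg0 perm1.
  have [-> | nzx] := eqVneq z x; last by rewrite fixo // inE => /eqP.
  have [// | nyx] := eqVneq y x.
  by rewrite porbit_sym fixo // inE => /eqP.
congr #|pred_of_set _|; apply/setP=> B;
  apply/imsetP/imsetP=> [[y _ ->] | [y _ ->]]; last by exists y.
have [py | npy] := boolP (y \in porbit p x).
  by exists x; [rewrite setU11 | apply/eqP; rewrite eq_porbit_mem].
by exists y; rewrite // !inE npy orbT.
Qed.

(** * Action on the blocks of an invariant partition *)

Section BlockPerms.

Variables (T : finType) (Q : {set {set T}}).
Hypothesis partQ : partition Q [set: T].

(** It acts on all of [{set T}] and fixes every set outside [Q]; such sets add nothing to the index,
    so [riemann_hurwitz] applies with [A := Q]. *)
Definition block_perm (s : {perm T}) : {perm {set T}} :=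
  restr_perm Q (actperm 'P^* s).

Lemma block_permE s B : s \in 'N(Q | 'P^*) -> B \in Q -> block_perm s B = s @: B.
Proof.
move=> Ns QB; rewrite /block_perm restr_permE //; first by rewrite actpermE.
apply/astabsP=> A; rewrite /= apermE actpermE; exact: (astabsP Ns).
Qed.

Lemma block_perm_on s : perm_on Q (block_perm s).
Proof. exact: restr_perm_on. Qed.

Lemma block_permX s B i : s \in 'N(Q | 'P^*) -> B \in Q ->
  (block_perm s ^+ i) B = (s ^+ i) @: B.
Proof.
move=> Ns QB; elim: i => [|i IHi]; first by rewrite !expg0 perm1 imset_perm1.
rewrite expgSr permM IHi block_permE //.
  by rewrite -imset_comp; apply: eq_imset => z; rewrite expgSr permM.
by have /astabsP-> := groupX i Ns.
Qed.

Lemma block_permM : {in 'N(Q | 'P^*) &, {morph block_perm : s t / s * t}}.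
Proof.
move=> s t Ns Nt; apply/permP=> B; rewrite permM.
have [QB | nQB] := boolP (B \in Q); last by rewrite !(out_perm (block_perm_on _)).
have QsB : s @: B \in Q by have /astabsP-> := Ns.
rewrite !block_permE ?groupM // -imset_comp.
by apply: eq_imset => z; rewrite permM.
Qed.

Lemma block_perm1 : block_perm 1 = 1.
Proof.
apply/permP=> B; rewrite perm1.
have [QB | nQB] := boolP (B \in Q); last by rewrite !(out_perm (block_perm_on _)).
by rewrite block_permE ?group1 // imset_perm1.
Qed.

Lemma block_eq A B x : A \in Q -> B \in Q -> x \in A -> x \in B -> A = B.
Proof.
case/and3P: partQ => _ tiQ _ QA QB Ax Bx; apply/eqP/negPn/negP => neq.
by have := trivIsetP tiQ _ _ QA QB neq => /disjoint_setI0/setP/(_ x);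
  rewrite !inE Ax Bx.
Qed.

(** A moved block lies entirely in the support of [s]. As [s] is transitive on its support, the
    moved blocks form a single orbit of [k.+1] blocks, with [m] points of the support in each. *)
Lemma block_perm_index s m :
    s \in 'N(Q | 'P^*) -> cycle_on (psupport s) s -> 0 < m ->
    {in Q, forall B : {set T}, #|B| = m} ->
  block_perm s = 1 \/
  exists2 k, (#|{set T}| <= #|porbits (block_perm s)| + k)%N &
             (k < #|Q|)%N /\ (m * k.+1 <= #|psupport s|)%N.
Proof.
move=> Ns [_ cyc] m0 unif; set b := block_perm s.
have [-> | /perm_neq1[B bB]] := eqVneq b 1; [by left | right].
have QB : B \in Q by apply: contraNT bB => nQB;
  rewrite (out_perm (block_perm_on s)).
have movedD A : A \in Q -> b A != A -> A \subset psupport s.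
  move=> QA bA; apply/subsetP=> x Ax; rewrite inE; apply: contraNneq bA => sx.
  rewrite /b block_permE //; apply/eqP; apply: (block_eq (x := x)) => //.
    by have /astabsP-> := Ns.
  by rewrite -[in X in X \in _]sx imset_f.
have [x0 Bx0] : exists x, x \in B by apply/card_gt0P; rewrite unif.
have orbB A : A \notin porbit b B -> b A = A.
  move=> nBA; apply/eqP/negPn/negP => bA.
  have QA : A \in Q by apply: contraNT bA => nQA;
    rewrite (out_perm (block_perm_on s)).
  have [y Ay] : exists x, x \in A by apply/card_gt0P; rewrite unif.
  have Dy := subsetP (movedD A QA bA) y Ay.
  have Dx0 := subsetP (movedD B QB bB) x0 Bx0.
  move: Dy; rewrite -(cyc x0 Dx0) => /porbitP[i defy].
  case/negP: nBA; apply/porbitP; exists i; rewrite block_permX //.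
  apply: (block_eq (x := y)) => //; last by rewrite defy imset_f.
  by have /astabsP-> := groupX i Ns.
have sPQ : porbit b B \subset Q.
  apply/subsetP=> A /porbitP[i ->]; rewrite block_permX //.
  by have /astabsP-> := groupX i Ns.
exists #|porbit b B|.-1.
  have := card_porbits_cycle orbB; have := card_porbit_neq0 b B; arith.
have P0 : 0 < #|porbit b B| by rewrite lt0n card_porbit_neq0.
split; first by have := subset_leq_card sPQ; arith.
rewrite prednK // mulnC.
have partP : partition (porbit b B) (cover (porbit b B)).
  have /and3P[_ tiQ nQ0] := partQ; apply/and3P; split=> //.
    exact: trivIsetS tiQ.
  by apply: contra nQ0; apply: (subsetP sPQ).
rewrite -(card_uniform_partition (n := m) _ partP); last first.
  by move=> A /(subsetP sPQ)/unif.
apply: subset_leq_card; apply/bigcupsP=> A PA;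
  apply: (movedD A (subsetP sPQ A PA)).
apply: contra bB => /eqP bA; move: PA; rewrite porbit_sym => /porbitP[i ->].
by rewrite permX_fix // bA.
Qed.

End BlockPerms.

(** Here [c] counts the cycles that move blocks. Each of them has [k <= n.-1] and
    [e - 1 >= m * k + (m - 1)]; each of the others still contributes [e - 1 >= 1]. *)
Lemma sum_index_bound (I : eqType) (s : seq I) (k e : I -> nat) m n : 1 < m ->
    {in s, forall i, k i = 0 \/ (k i < n /\ m * (k i).+1 <= e i)%N} ->
    {in s, forall i, 1 < e i} ->
  exists c, [/\ c <= size s, \sum_(i <- s) k i <= c * n.-1 &
    m * (\sum_(i <- s) k i) + (m - 1) * c + (size s - c) <=
      \sum_(i <- s) (e i - 1)]%N.
Proof.
move=> m1; elim: s => [|i s IHs] ks es; first by exists 0%N;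
  rewrite !big_nil !muln0.
have [||c [les lek lee]] := IHs; try by move=> j sj; (apply: ks || apply: es);
  rewrite inE sj orbT.
have e1 := es i (mem_head _ _); rewrite !big_cons.
move: (\sum_(j <- s) k j)%N (\sum_(j <- s) (e j - 1))%N lek lee => N E lek lee.
have [k0 | [kn ke]] := ks i (mem_head _ _).
  by exists c; rewrite k0 /=; clear - les lek lee e1; split; lia.
by exists c.+1; move: (k i) (e i) kn ke => k' e' kn ke /=;
  clear - m1 les lek lee kn ke;
   split; nia.
Qed.

(* A cycle that moves blocks of size m permutes them in a cycle shorter by a
   factor m; Riemann-Hurwitz for the blocks then leaves room for two cycles. *)
Theorem genus0_primitive (T : finType) (ps : seq {perm T}) :
    {in ps, forall p, cycle_on (psupport p) p} ->
    {in ps, forall p, 1 < #|psupport p|} ->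
    \prod_(p <- ps) p = 1 ->
    [transitive <<[set:: ps]>>, on [set: T] | 'P] ->
    (\sum_(p <- ps) (#|psupport p| - 1) = 2 * #|T| - 2)%N ->
    2 < size ps ->
  [primitive <<[set:: ps]>>, on [set: T] | 'P].
Proof.
move=> cyc gt1 prod1 trG genus0 lt2r; rewrite /primitive trG /=.
apply/existsP=> -[Q /and3P[partQ actQ /andP[lt1Q ltQT]]].
have sGN : {subset <<[set:: ps]>> <= 'N(Q | 'P^*)} by apply/subsetP.
have psN p : p \in ps -> p \in 'N(Q | 'P^*).
  by move=> ps_p; apply/sGN/mem_gen; rewrite inE.
have [B0 QB0] : exists B, B \in Q by apply/card_gt0P; arith.
have nonempty B : B \in Q -> exists x, x \in B.
  move=> QB; apply/set0Pn; have /and3P[_ _] := partQ.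
  by apply: contraNneq => <-.
have transQ A B : A \in Q -> B \in Q -> exists2 h :
  {perm T}, h \in <<[set:: ps]>> & h @: A = B.
  move=> QA QB; have [[x Ax] [y By]] := (nonempty A QA, nonempty B QB).
  have [h Gh hx] := atransP2 trG (in_setT x) (in_setT y); exists h => //.
  apply: (block_eq partQ (x := y)) => //; last by rewrite hx; apply: imset_f.
  by have /astabsP-> := sGN h Gh.
pose m := #|B0|.
have unif : {in Q, forall B : {set T}, #|B| = m}.
  by move=> B QB; have [h _ <-] := transQ B0 B QB0 QB; rewrite card_imset_perm.
have oT := card_uniform_partition unif partQ; rewrite cardsT in oT.
have m0 : 0 < m by have [x B0x] := nonempty B0 QB0; apply/card_gt0P; exists x.
have m1 : 1 < m by rewrite cardsT oT in ltQT; clear -ltQT m0; nia.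
pose k p := (#|{set T}| - #|porbits (block_perm Q p)|)%N.
have kP : {in ps, forall p, k p =
  0 \/ (k p < #|Q| /\ m * (k p).+1 <= #|psupport p|)%N}.
  move=> p ps_p; have [b1 | [j lej [ltj je]]] :=
    block_perm_index partQ (psN p ps_p) (cyc p ps_p) m0 unif.
    by left; rewrite /k b1 card_porbits1 subnn.
  have lek : k p <= j by rewrite /k; arith.
  by right; split; [arith | apply: leq_trans je; rewrite leq_mul2l ltnS lek orbT].
have := @riemann_hurwitz _ Q [seq block_perm Q p | p <- ps];
  rewrite !big_map => /(_ _ _).
rewrite -/(\sum_(p <- ps) k p)%N => /[dup] RH _.
have {}RH : (2 * (#|Q| - 1) <= \sum_(p <- ps) k p)%N.
  apply: RH.
    suff -> : \prod_(p <- ps) block_perm Q p = block_perm Q (\prod_(p <- ps) p).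
      by rewrite prod1 block_perm1.
    have {psN lt2r genus0 trG actQ sGN transQ gt1 cyc prod1 kP} :
      {in ps, forall p, p \in 'N(Q | 'P^*)} by [].
    elim: ps => [|p s IHs] sN; first by rewrite !big_nil block_perm1.
    have sN' : {in s, forall p, p \in 'N(Q | 'P^*)}.
      by move=> q sq; apply: sN; rewrite inE sq orbT.
    have Np : p \in 'N(Q | 'P^*) by apply: sN; rewrite mem_head.
    have Ns : \prod_(q <- s) q \in 'N(Q | 'P^*) by rewrite big_seq;
      apply: group_prod.
    by rewrite !big_cons block_permM ?IHs.
  move=> f fps A B QA QB; have [h Gh <-] := transQ A B QA QB.
  (* The elements preserving the colour of every block form a group containing the generators, so
     transitivity on blocks leaves one colour only. *)
  pose K := [set h in 'N(Q | 'P^*) | [forall C in Q, f (h @: C) == f C]].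
  have gK : group_set K.
    apply/group_setP; split=> [|u v].
      by apply/setIdP; split; [exact: group1 | apply/forall_inP=> C _;
        rewrite imset_perm1].
    move=> /setIdP[Nu /forall_inP fu] /setIdP[Nv /forall_inP fv].
    apply/setIdP; split; [exact: groupM | apply/forall_inP=> C QC].
    have -> : (u * v) @: C = v @: (u @: C).
      by rewrite -imset_comp; apply: eq_imset => z; rewrite permM.
    by rewrite (eqP (fv _ _)) ?fu //; have /astabsP-> := Nu.
  have : h \in Group gK.
    move: h Gh; apply/subsetP; rewrite gen_subG; apply/subsetP=> p;
      rewrite inE => ps_p.
    apply/setIdP; split; [exact: psN | apply/forall_inP=> C QC].
    by rewrite -(block_permE (psN p ps_p) QC) fps ?map_f.
  by case/setIdP=> _ /forall_inP/(_ A QA)/eqP.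
have [c [lec lek lee]] := sum_index_bound m1 kP gt1.
move: RH lek lee; rewrite genus0 oT; move: (\sum_(p <- ps) k p)%N => N RH lek lee.
have c2 : 1 < c by case: c lek {lec lee} => [|[|c]] // lek; clear -RH lek lt1Q;
  lia.
have mN : (m * (2 * (#|Q| - 1)) <= m * N)%N by rewrite leq_mul2l RH orbT.
move: m m1 mN lee {oT unif m0 kP} => m m1 mN lee.
(* With n blocks and r cycles, genus 0 reads [m N + (m - 1) c + (r - c) <= 2 m n - 2], and
   [N >= 2 (n - 1)] leaves [(m - 1) c + (r - c) <= 2 (m - 1)]. Since [c >= 2], this forces [c = 2]
   and [r <= 2]. *)
have {mN lee} le2 : ((m - 1) * c + (size ps - c) <= 2 * (m - 1))%N.
  have := leq_mul lt1Q (leqnn m); move: mN lee;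
    rewrite mulnCA mulnBr muln1 (mulnC m).
  move: (#|Q| * m)%N (m * N)%N ((m - 1) * c)%N (size ps - c)%N => a b e x.
  by clear; lia.
have [eqc | ltc] : c = 2 \/ 2 < c by clear -c2; lia.
  by move: le2; rewrite eqc; clear - lt2r m1; lia.
by have := leq_mul (leqnn (m - 1)) ltc; clear - m1 le2; nia.
Qed.

(** * Three-cycles and the alternating group *)

Lemma cycle_on_support (T : finType) (D : {set T}) (s : {perm T}) :
  1 < #|D| -> cycle_on D s -> psupport s = D.
Proof.
move=> lt1D [onD orbD]; apply/setP=> x; rewrite inE.
apply/idP/idP=> [sx | Dx]; first by apply: contraR sx => /(out_perm onD) ->.
apply: contraTneq lt1D => sx; rewrite -(orbD x Dx) -leqNgt.
rewrite (_ : porbit s x = [set x]) ?cards1 //; apply/setP=> y; rewrite inE.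
by apply/porbitP/eqP=> [[i ->] | ->];
  [apply: permX_fix | exists 0%N; rewrite expg0 perm1].
Qed.

Lemma psupportJ (T : finType) (s h : {perm T}) :
  psupport (s ^ h) = h @: psupport s.
Proof.
apply/setP=> x; rewrite mem_imset_permV !inE -{1 2}(permKV h x) permJ.
by rewrite (inj_eq perm_inj).
Qed.

Lemma mem_psupport (T : finType) (s : {perm T}) x :
  (s x \in psupport s) = (x \in psupport s).
Proof. by rewrite !inE (inj_eq perm_inj). Qed.

Lemma cards3 (T : finType) (p q r : T) : p != q -> p != r -> q != r ->
  #|[set p; q; r]| = 3.
Proof.
by move=> pq pr qr; rewrite -setUA !cardsU1 cards1 !inE (negPf pq) (negPf pr) qr.
Qed.

Lemma cycle_on3 (T : finType) (w : {perm T}) p q r :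
  w p = q -> w q = r -> w r = p -> perm_on [set p; q; r] w ->
    cycle_on [set p; q; r] w.
Proof.
move=> wp wq wr onD; split=> //.
have sub : [set p; q; r] \subset porbit w p.
  apply/subsetP=> z; rewrite !inE -orbA => /or3P[] /eqP->; first exact: porbit_id.
    by rewrite -wp; apply: (mem_porbit w 1).
  by rewrite -wq -wp -permM; apply: (mem_porbit w 2).
have eqD : porbit w p = [set p; q; r].
  apply/eqP; rewrite eqEsubset sub andbT; apply/subsetP=> _ /porbitP[i ->].
  elim: i => [|i IHi]; first by rewrite perm1 !inE eqxx.
  by rewrite expgSr permM perm_closed.
by move=> z; rewrite -eqD => /[dup] + _; rewrite -eq_porbit_mem => /eqP.
Qed.

(** Away from [p] a point is moved by at most one of [x] and [y]. Tracing the images shows that the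
    commutator sends [p] to [y p], [y p] to [x p] and [x p] to [p], and fixes everything else. *)
Lemma commg_cycle3 (T : finType) (x y : {perm T}) p :
  psupport x :&: psupport y = [set p] ->
  exists2 D : {set T}, #|D| = 3 & cycle_on D [~ x, y].
Proof.
move=> Ip; have /setP/(_ p) := Ip; rewrite !inE eqxx => /andP[xp yp].
have Ixy z : z != p -> x z != z -> y z = z.
  move=> neq xz; apply/eqP/negPn/negP => yz.
  by have /setP/(_ z) := Ip; rewrite !inE xz yz (negPf neq).
have Iyx z : z != p -> y z != z -> x z = z.
  by move=> neq yz; apply/eqP/negPn/negP => xz; rewrite Ixy ?eqxx in yz.
have fixV (q : {perm T}) z : (q^-1 z == z) = (q z == z).
  by rewrite -(inj_eq (@perm_inj _ q)) permKV eq_sym.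
pose u := x p; pose v := y p; set w := [~ x, y].
have neq_up : u != p by []. 
have neq_vp : v != p by [].
have yu : y u = u by apply: Ixy; rewrite ?(inj_eq perm_inj).
have xv : x v = v by apply: Iyx; rewrite ?(inj_eq perm_inj).
have neq_uv : u != v by apply: contraNneq xp => eq;
  rewrite -(inj_eq (@perm_inj _ x)) -/u eq xv.
have wE z : w z = y (x (y^-1 (x^-1 z))) by rewrite /w /commg /conjg !permM.
have wu : w u = p.
  by rewrite wE permK (Iyx (y^-1 p)) ?permKV ?fixV // eq_sym fixV.
have wv : w v = u.
  have -> : w v = y (x (y^-1 v)) by rewrite wE -{1}xv permK.
  by rewrite permK -/u yu.
have wp : w p = v.
  rewrite wE (_ : y^-1 (x^-1 p) = x^-1 p) ?permKV //.
  apply/eqP; rewrite fixV; apply/eqP/Ixy; rewrite ?fixV //.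
  by rewrite permKV eq_sym fixV.
have onD : perm_on [set p; v; u] w.
  apply/subsetP=> z; rewrite !inE; apply: contraNT;
    rewrite !negb_or -andbA => /and3P[zp zv zu].
  rewrite wE; have [xz | xz] := eqVneq (x z) z.
    have -> : x^-1 z = z by rewrite -{1}xz permK.
    have [yz | yz] := eqVneq (y z) z.
      by rewrite -{1}yz permK xz yz.
    rewrite (Iyx (y^-1 z)) ?permKV //; last by rewrite eq_sym fixV.
    by rewrite -(inj_eq (@perm_inj _ y)) permKV.
  have -> : y^-1 (x^-1 z) = x^-1 z.
    apply/eqP; rewrite fixV; apply/eqP/Ixy; last by rewrite permKV eq_sym fixV.
    by rewrite -(inj_eq (@perm_inj _ x)) permKV.
  by rewrite permKV Ixy.
by exists [set p; v; u]; [apply: cards3 | apply: cycle_on3]; rewrite // eq_sym.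
Qed.

Lemma tperm_mul_cube (T : finType) (a b c : T) : a != b -> a != c -> b != c ->
  (tperm a b * tperm a c) ^+ 3 = 1.
Proof.
move=> ab ac bc; have xyx : tperm a b * tperm a c * tperm a b = tperm b c.
  by rewrite -{1}tpermV -mulgA -/(conjg _ _) tpermJ tpermL tpermD // eq_sym.
have yxy : tperm a c * tperm a b * tperm a c = tperm c b.
  by rewrite -{1}tpermV -mulgA -/(conjg _ _) tpermJ tpermL tpermD // eq_sym.
rewrite !expgS expg0 mulg1 !mulgA xyx -!mulgA (mulgA (tperm a c)) yxy.
by rewrite (tpermC c) tperm2.
Qed.

Lemma dtuple_setT (T : finType) n (t : n.-tuple T) :
  (t \in n.-dtuple([set: T])) = uniq t.
Proof. by rewrite inE; apply: andb_idr => _; apply/subsetP=> x _;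
  rewrite inE. Qed.

(** Any permutation agrees with an element of [G] outside two fixed points [x] and [y], so it lies
    in [G] or in [tperm x y * G]. A subgroup of index at most 2 contains all elements of order 3,
    hence all products of two transpositions. *)
Lemma transitive_Alt (T : finType) (G : {group {perm T}}) : 1 < #|T| ->
  [transitive^(#|T| - 2) G, on [set: T] | 'P] -> 'Alt_T \subset G.
Proof.
move=> lt1T trG.
have sz : size (take (#|T| - 2) (enum T)) == (#|T| - 2)%N.
  by rewrite size_take -cardE; case: ltnP; arith.
pose t := Tuple sz.
have ut : uniq t by rewrite take_uniq ?enum_uniq.
have dt (p : {perm T}) : [tuple of map p t] \in (#|T| - 2).-dtuple([set: T]).
  by rewrite dtuple_setT map_inj_uniq //; apply: perm_inj.
have o2 : #|~: [set z in t]| == 2.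
  rewrite -(eqn_add2l #|[set z in t]|) cardsC cardsE (card_uniqP ut) (eqP sz);
    apply/eqP; arith.
have /cards2P[x [y [neq_xy def2]]] := o2.
have cosets (s : {perm T}) : s \in G \/ exists2 h, h \in G & s = tperm x y * h.
  have [h Gh /(congr1 val)/= eqst] := atransP2 trG (dt 1) (dt s).
  have eqsh z : z \in t -> s z = h z.
    move: eqst; rewrite -map_comp => /eq_in_map eqst tz.
    by rewrite eqst //= apermE perm1.
  have on2 : perm_on [set x; y] (s * h^-1).
    rewrite -def2; apply/subsetP=> z; rewrite !inE; apply: contraNN => tz.
    by rewrite permM eqsh ?permK.
  have [fx | mx] := eqVneq ((s * h^-1) x) x.
    left; suff /eqP : s * h^-1 = 1 by rewrite -eq_mulgV1 => /eqP->.
    apply: (@perm_on_id _ _ [set y]); last by rewrite cards1.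
    apply/subsetP=> z sz_z; have := subsetP on2 z sz_z;
      rewrite !inE => /orP[/eqP eqz|//].
    by move: sz_z; rewrite eqz inE fx eqxx.
  right; exists h => //; rewrite -[LHS](mulgKV h); congr (_ * _).
  have img z : z \in [set x; y] -> (s * h^-1) z \in [set x; y]
    by rewrite perm_closed.
  have sx : (s * h^-1) x = y.
    by have := img x; rewrite !inE eqxx (negPf mx) /= => /(_ isT)/eqP.
  apply/permP=> z; case: tpermP => [->|->|]; first exact: sx.
    have := img y; rewrite !inE eqxx orbT => /(_ isT)/orP[/eqP // | ].
    by rewrite -{2}sx (inj_eq perm_inj) eq_sym (negPf neq_xy).
  by move=> /eqP zx /eqP zy; apply: out_perm on2 _; rewrite !inE negb_or zx.
(* If [q ^+ 2] is in [G], so is its inverse [q]. If [q] and [q ^+ 2] both lie in [tperm x y * G],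
   cancelling the transposition writes [q] as a quotient of elements of [G]. *)
have cube q : q ^+ 3 = 1 -> q \in G.
  move=> q3; have [//|[h Gh eqq]] := cosets q.
  have [Gqq|[k Gk eqqq]] := cosets (q ^+ 2).
    by rewrite -groupV (_ : q^-1 = q ^+ 2) //; apply/eqP;
      rewrite eq_invg_mul -expgS q3.
  have -> : q = h^-1 * k; last by rewrite groupM ?groupV.
  have : q * q = tperm x y * k by rewrite -eqqq expgS expg1.
  by rewrite {1}eqq -mulgA => /mulgI <-; rewrite mulKg.
have two a b c : a != b -> a != c -> tperm a b * tperm a c \in G.
  move=> ab ac; have [-> | bc] := eqVneq b c; first by rewrite tperm2 group1.
  exact/cube/tperm_mul_cube.
have pair a b c e : a != b -> c != e -> tperm a b * tperm c e \in G.
  move=> ab ce; have [eqac | ac] := eqVneq a c; first by rewrite -eqac in ce *;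
    apply: two.
  have -> : tperm a b * tperm c e =
    (tperm a b * tperm a c) * (tperm c a * tperm c e).
    by rewrite (tpermC c a) mulgA -(mulgA (tperm a b)) tperm2 mulg1.
  by apply: groupM; apply: two; rewrite // eq_sym.
apply/subsetP=> s; rewrite Alt_even; have [ts -> dts] := prod_tpermP s.
rewrite odd_perm_prod //; have [n] := ubnP (size ts).
elim: n ts dts => // n IHn [|[a b] [|[c e] ts]] //=;
  first by rewrite big_nil group1.
case/and3P=> ab ce dts ltn; rewrite !negbK => even_ts.
by rewrite !big_cons mulgA groupM ?pair ?IHn //; arith.
Qed.

(* If [h] moves the support of [t] so that it meets the old one in a single
   point, then [t] and [t ^ h] have a 3-cycle as commutator. *)
Lemma transitive_cycle3 (T : finType) (G : {group {perm T}}) k t :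
    [transitive^k G, on [set: T] | 'P] -> t \in G -> t != 1 ->
    #|psupport t| <= k -> (2 * #|psupport t| <= #|T|.+1)%N ->
  exists c (D : {set T}), [/\ c \in G, #|D| = 3 & cycle_on D c].
Proof.
move=> trG Gt /perm_neq1[p tp] lek le2.
have {trG lek} trG := ntransitive_weak lek trG.
set X := psupport t in trG le2 *; have Xp : p \in X by rewrite inE.
(* An element taking [s1] to [s2] fixes [p] and moves the rest of [X] off [X]; the bound
   [2 * #|X| <= #|T|.+1] supplies the [#|X| - 1] points needed outside. *)
pose s1 := p :: enum (X :\ p); pose s2 := p :: take (#|X| - 1) (enum (~: X)).
have oX : #|X| = #|X :\ p|.+1 by rewrite (cardsD1 p X) Xp.
have sz1 : size s1 == #|X| by rewrite /= -cardE oX.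
have sz2 : size s2 == #|X|.
  by rewrite /= size_take -cardE; have := cardsC X; case: ltnP; arith.
have d1 : Tuple sz1 \in #|X|.-dtuple([set: T]).
  by rewrite dtuple_setT /= enum_uniq mem_enum !inE eqxx.
have d2 : Tuple sz2 \in #|X|.-dtuple([set: T]).
  rewrite dtuple_setT /= take_uniq ?enum_uniq // andbT.
  by apply/negP=> /mem_take; rewrite mem_enum inE Xp.
have [h Gh /(congr1 val)/= [hp hs]] := atransP2 trG d1 d2.
have hX z : z \in X -> z != p -> h z \notin X.
  move=> Xz zp; have : h z \in take (#|X| - 1) (enum (~: X)).
    by rewrite hs; apply: (map_f (aperm^~ h)); rewrite mem_enum in_setD1 zp.
  by move/mem_take; rewrite mem_enum inE.
have IX : psupport t :&: psupport (t ^ h) = [set p].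
  apply/setP=> z; rewrite psupportJ -/X !in_setI in_set1;
    apply/andP/eqP=> [[Xz]|->].
    case/imsetP=> w Xw defz; have [eqwp | neq] := eqVneq w p.
      by rewrite defz eqwp [h p](esym hp).
    by have := hX w Xw neq; rewrite -defz Xz.
  by split=> //; rewrite [p in p \in _]hp; apply: imset_f.
have [D oD cD] := commg_cycle3 IX.
by exists [~ t, t ^ h], D; split=> //; rewrite groupR ?groupJ.
Qed.

Theorem primitive_cycle3_Alt (T : finType) (G : {group {perm T}}) (D : {set T})
  c :
    [primitive G, on [set: T] | 'P] -> c \in G -> #|D| = 3 -> cycle_on D c ->
  'Alt_T \subset G.
Proof.
move=> primG Gc oD cycD; have leDT := max_card D.
apply: transitive_Alt; first by move: leDT; rewrite oD; arith.
have [ltDT | geDT] := ltnP #|D| #|T|.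
  have := primitive_cycle_ntrans primG Gc cycD (subsetT D).
  rewrite cardsT oD => H.
  have -> : (#|T| - 2 = (#|T| - 3).+1)%N by move: ltDT; rewrite oD; arith.
  by apply: H; move: ltDT; rewrite oD.
(* The 3-cycle has no fixed point, so the degree is 3 and plain transitivity is enough. *)
have -> : (#|T| - 2 = 1)%N by move: leDT geDT; rewrite oD; arith.
have [trG _] := andP primG; have [a _ _] := imsetP trG.
apply: (@stab_ntransitiveI _ _ _ _ _ _ a) => //; exact: ntransitive0.
Qed.

(** * Normal form for three cycles *)

Lemma next_mid (T : eqType) (l r : seq T) x y :
  uniq (l ++ x :: y :: r) -> next (l ++ x :: y :: r) x = y.
Proof.
move=> ul; rewrite -(next_rot (size l) ul) rot_size_cat.
by rewrite /= eqxx.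
Qed.

Lemma next_in_infix (T : eqType) (l m r : seq T) x y0 :
  uniq (l ++ m ++ r) -> x \in m -> x != last y0 m -> next (l ++ m ++ r) x \in m.
Proof.
move=> + mx; case/splitPr: m / mx => m1 [|y m2] ul;
  first by rewrite last_cat /= eqxx.
rewrite -catA /= catA in ul *; rewrite next_mid // => _.
by rewrite mem_cat !inE eqxx !orbT.
Qed.

Lemma next_notin (T : eqType) (l : seq T) x : x \notin l -> next l x = x.
Proof. by move=> nlx; rewrite next_nth (negPf nlx). Qed.

(** Once [P] holds along the path it persists. The condition [f z \in l] excuses the last point,
    which closes the cycle outside [l]. *)
Lemma fpath_split (T : eqType) (f : T -> T) (P : pred T) x l :
    fpath f x l -> {in l, forall z, P z -> f z \in l -> P (f z)} ->
  exists c a, [/\ l = c ++ a, all (predC P) c & all P a].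
Proof.
elim: l x => [|y l IHl] x; first by exists [::], [::].
rewrite /= => /andP[_ fl] clP.
have clP' : {in l, forall z, P z -> f z \in l -> P (f z)}.
  by move=> z lz Pz lfz; apply: (clP z) => //; rewrite in_cons ?lz ?lfz orbT.
have [Py | nPy] := boolP (P y).
  exists [::], (y :: l); split=> //=; rewrite Py /=.
  elim: l y fl Py clP {IHl clP'} => //= z l IHl y /andP[/eqP fy fl] Py clP.
  have Pz : P z by rewrite -fy; apply: (clP y) => //;
    rewrite ?fy !in_cons eqxx ?orbT.
  rewrite Pz; apply: IHl fl Pz _ => w lw Pw lfw.
  move: lw lfw; rewrite !(in_cons z) => lw lfw.
  by apply: (clP w) => //; rewrite !in_cons ?lw ?lfw !orbT.
have [c [a [-> allc alla]]] := IHl y fl clP'.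
by exists (y :: c), a; split; rewrite //= nPy.
Qed.

Lemma cycle_on_next (T : finType) (D : {set T}) (s : {perm T}) x :
    cycle_on D s -> x \in D -> let l := traject s (s x) #|D|.-1 in
  [/\ uniq (x :: l), s =1 next (x :: l), x :: l =i D & fcycle s (x :: l)].
Proof.
move=> [onD orbD] Dx l; have D0 : 0 < #|D| by apply/card_gt0P; exists x.
have defl : x :: l = traject s x #|D| by rewrite -[in RHS](prednK D0) trajectS.
have memD : x :: l =i D by move=> z; rewrite defl -(orbD x Dx) porbit_traject.
have ul : uniq (x :: l) by rewrite defl -(orbD x Dx) uniq_traject_porbit.
have cl : fcycle s (x :: l).
  rewrite /= (_ : rcons l x = traject s (s x) #|D|) ?fpath_traject //.
  rewrite -(prednK D0) trajectSr -/l; congr (rcons _ _).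
  by rewrite -iterSr prednK // -(orbD x Dx) iter_porbit.
split=> // z; have [lz | nlz] := boolP (z \in x :: l).
  by have := next_cycle cl lz => /eqP.
by rewrite next_notin // (out_perm onD) // -memD.
Qed.

Lemma exists_map_perm (T : finType) (l l' : seq T) :
  uniq l -> uniq l' -> size l = size l' -> exists h : {perm T}, map h l' = l.
Proof.
move=> ul ul' eqs; have lel : size l <= #|T| by rewrite -(card_uniqP ul) max_card.
have trS := ntransitive_weak lel (Sym_trans T).
have sz' : size l' == size l by rewrite eqs.
have [||h _ /(congr1 val)/= eqh] :=
  atransP2 trS (x := Tuple sz') (y := in_tuple l).
- by rewrite dtuple_setT.
- by rewrite dtuple_setT.
by exists h.
Qed.

Lemma conj_next (T : finType) (s s' h : {perm T}) (l l' : seq T) :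
  uniq l' -> s =1 next l -> s' =1 next l' -> map h l' = l -> s' ^ h = s.
Proof.
move=> ul' El El' eqh; apply/permP=> x.
by rewrite -(permKV h x) permJ El' -(next_map (@perm_inj _ h) ul') eqh El.
Qed.

(* Genus 0 reads e_1 + e_2 + e_3 = 2 |T| + 1. *)
Definition genus0_triple (T : finType) (s1 s2 s3 : {perm T}) :=
  [/\ [/\ cycle_on (psupport s1) s1, cycle_on (psupport s2) s2 &
          cycle_on (psupport s3) s3],
      s1 * s2 * s3 = 1,
      psupport s1 :|: psupport s2 :|: psupport s3 = [set: T] &
      (#|psupport s1| + #|psupport s2| + #|psupport s3| = (2 * #|T|).+1)%N].

Lemma genus0_triple_rot (T : finType) (s1 s2 s3 : {perm T}) :
  genus0_triple s1 s2 s3 -> genus0_triple s2 s3 s1.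
Proof.
case=> [[c1 c2 c3] prod1 cov sum]; split=> //.
- apply: (mulgI s1); rewrite mulgA mulgA prod1 mul1g mulg1 //.
- by rewrite setUC setUA.
- by rewrite -sum addnC addnA.
Qed.

Section Triple.

Variables (T : finType) (s1 s2 s3 : {perm T}).
Hypothesis trip : genus0_triple s1 s2 s3.

Local Notation S1 := (psupport s1).
Local Notation S2 := (psupport s2).
Local Notation S3 := (psupport s3).

Lemma triple_mulE x : s3 (s2 (s1 x)) = x.
Proof. by have [_ prod1 _ _] := trip; rewrite -!permM mulgA prod1 perm1. Qed.

Lemma psupportN (s : {perm T}) x : (x \notin psupport s) -> s x = x.
Proof. by rewrite inE negbK => /eqP. Qed.

Lemma triple_fix12 x : x \notin S1 -> x \in S2.
Proof.
move=> n1; apply/negPn/negP=> n2; have := triple_mulE x.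
rewrite (psupportN n1) (psupportN n2) => /eqP fx3.
have [_ _ /setP/(_ x) + _] := trip.
by rewrite !in_setU (negPf n1) (negPf n2) !inE fx3.
Qed.

Lemma triple_fix3 x : x \notin S3 -> s2 (s1 x) = x.
Proof. by move=> n3; apply: (@perm_inj _ s3); rewrite triple_mulE psupportN. Qed.

End Triple.

Section NormalForm.

Variables (T : finType) (s1 s2 s3 : {perm T}).
Hypothesis trip : genus0_triple s1 s2 s3.
Let trip' := genus0_triple_rot trip.
Let trip'' := genus0_triple_rot trip'.

Local Notation S1 := (psupport s1).
Local Notation S2 := (psupport s2).
Local Notation S3 := (psupport s3).

(* Every point is moved by at least two of the three cycles, and their lengths
   add up to 2 |T| + 1. *)
Lemma triple_point : exists o, S1 :&: S2 :&: S3 = [set o].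
Proof.
have U12 : S1 :|: S2 = [set: T].
  apply/setP=> x; rewrite in_setU in_setT; have [//|n1] := boolP (x \in S1).
  exact: triple_fix12 trip x n1.
have U123 : (S1 :&: S2) :|: S3 = [set: T].
  apply/setP=> x; rewrite in_setU in_setI in_setT.
  have [i3|n3] := boolP (x \in S3); first by rewrite orbT.
  rewrite (triple_fix12 trip'' n3) orbF /=; apply/negPn/negP=> n2.
  by rewrite (triple_fix12 trip' n2) in n3.
have [_ _ _ sum] := trip.
have := cardsUI S1 S2; have := cardsUI (S1 :&: S2) S3;
  rewrite U12 U123 cardsT => e1 e2.
by apply/cards1P; rewrite -(eqn_add2l #|T|) e1; apply/eqP; arith.
Qed.

(** Every point except [o] is fixed by exactly one cycle. On the points fixed by [s3], [s2] undoes
    [s1]; so [s1], once it enters the support of [s2], stays there until it returns to [o], and this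
    separates [C] from [A]. For the same reason [s2] runs through [A] backwards before it reaches
    [B]. *)
Lemma normal_form : exists o A B C,
  [/\ uniq (o :: C ++ A ++ B),
      [/\ A =i ~: S3, B =i ~: S1 & C =i ~: S2],
      [/\ o \in S1, o \in S2 & o \in S3],
      s1 =1 next (o :: C ++ A) & s2 =1 next (o :: rev A ++ B)].
Proof.
have [o Io] := triple_point.
have [[c1 c2 c3] _ _ sum] := trip.
have /and3P[o1 o2 o3] : [&& o \in S1, o \in S2 & o \in S3].
  by have /setP/(_ o) := Io; rewrite !in_setI set11 -andbA.
have uniq_o x : x \in S1 -> x \in S2 -> x \in S3 -> x = o.
  by move=> x1 x2 x3; apply/set1P; rewrite -Io !in_setI x1 x2.
have [] := cycle_on_next c1 o1; set M := traject _ _ _ => uM E1 memM cM.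
have fM : fpath s1 o M by apply/fpathP; exists #|S1|.-1.
have noM z : z \in M -> z != o.
  by move=> Mz; apply: contraTneq uM => <-; rewrite /= Mz.
have [C [A [eqM allC allA]]] : exists C A,
    [/\ M = C ++ A, all (predC (mem S2)) C & all (mem S2) A].
  apply: (fpath_split fM) => z Mz /= S2z Ms1z.
  have S1z : z \in S1 by rewrite -memM inE Mz orbT.
  have n3 : z \notin S3 by apply: contra (noM z Mz) => S3z; apply/eqP/uniq_o.
  by rewrite -mem_psupport (triple_fix3 trip n3).
rewrite eqM in uM E1 memM cM noM.
have memA : A =i ~: S3.
  move=> z; rewrite in_setC; apply/idP/idP=> [Az | n3].
    have S1z : z \in S1 by rewrite -memM inE mem_cat Az !orbT.
    apply: contra (noM z _) => [S3z|]; last by rewrite mem_cat Az orbT.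
    by apply/eqP/uniq_o => //; apply: (allP allA _ Az).
  have S1z : z \in S1 by apply: triple_fix12 trip'' z n3.
  have S2z : z \in S2.
    by apply: contraR n3 => n2; apply: triple_fix12 trip' z n2.
  move: S1z; rewrite -memM inE mem_cat => /or3P[/eqP eqz | Cz | //].
    by rewrite eqz o3 in n3.
  by have /negP[] := allP allC z Cz.
have memC : C =i ~: S2.
  move=> z; rewrite in_setC; apply/idP/idP=> [Cz | n2];
    first exact: (allP allC z Cz).
  have S1z : z \in S1 by apply: contraR n2 => n1; apply: triple_fix12 trip z n1.
  move: S1z; rewrite -memM inE mem_cat => /or3P[/eqP eqz | // | Az].
    by rewrite eqz o2 in n2.
  by case/negP: n2; apply: (allP allA z Az).
have back z : z \in A -> s2 (s1 z) = z.
  by rewrite memA in_setC; apply: triple_fix3 trip z.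
(* As [s1] sends the last point of [A] to [o], [back] makes [s2] leave [o] towards that point and
   reverse each step of [s1] inside [A]. *)
have fA : fpath s2 o (rev A).
  have pA : path (fun z w => s2 w == z) (head o A) (behead (rcons A o)).
    have : forall z, z \in A -> s2 (s1 z) == z by move=> z /back->.
    move: cM; rewrite /= rcons_cat cat_path => /andP[_].
    move: (last o C) => y; case: (A) => //= a l /andP[_]. 
    elim: l a => /= [|b l IHl] a; first by rewrite !andbT => /eqP<- ->;
      rewrite ?mem_head.
    case/andP=> /eqP eqb pl bk; rewrite -eqb bk ?mem_head //= eqb IHl // => z lz.
    by apply: bk; rewrite inE lz orbT.
  case: (A) pA => [//|a l] /= pA.
  have := rev_path (frel s2) a (rcons l o); rewrite last_rcons belast_rcons => ->.
  exact: pA.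
have [] := cycle_on_next c2 o2; set L := traject _ _ _ => uL E2 memL cL.
have uA : uniq A by move: uM; rewrite /= cat_uniq => /and4P[].
have leA : size A <= #|S2|.-1.
  have : uniq (o :: A).
    by move: uM; rewrite /= mem_cat negb_or => /andP[/andP[_ ->]].
  move/card_uniqP => /= eqs; rewrite -ltnS -eqs prednK; last by apply/card_gt0P;
    exists o.
  apply: subset_leq_card; apply/subsetP=> z; rewrite inE => /predU1P[-> //|Az].
  exact: (allP allA z Az).
pose B := traject s2 (iter (size A) s2 (s2 o)) (#|S2|.-1 - size A).
have eqL : L = rev A ++ B.
  rewrite /L -(subnKC leA) trajectD -/B; congr (_ ++ _).
  by rewrite (fpathE fA) size_rev.
rewrite eqL in uL E2 memL.
have memB : B =i ~: S1.
  move=> z; rewrite in_setC; apply/idP/idP=> [Bz | n1].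
    apply/negP; rewrite -memM inE mem_cat => /or3P[/eqP eqz | Cz | Az].
    - by move: uL; rewrite /= mem_cat -eqz Bz orbT.
    - have := memC z; rewrite Cz in_setC => /esym/negP[].
      by rewrite -memL inE mem_cat Bz !orbT.
    - move: uL; rewrite /= cat_uniq => /and4P[_ _ /hasPn/(_ z Bz)].
      by rewrite mem_rev Az.
  have S2z : z \in S2 by apply: triple_fix12 trip z n1.
  move: S2z; rewrite -memL inE mem_cat mem_rev => /or3P[/eqP eqz | Az | //].
    by rewrite eqz o1 in n1.
  by case/negP: n1; rewrite -memM inE mem_cat Az !orbT.
exists o, A, B, C; split=> //.
move: uM uL; rewrite /= !mem_cat mem_rev !cat_uniq rev_uniq.
case/andP=> /norP[oC oA] /and3P[-> hCA ->] /andP[/norP[_ oB]] /and3P[_ hAB ->].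
rewrite (negPf oC) (negPf oA) (negPf oB) /= !andbT.
have -> /= : ~~ has [in A] B.
  by apply/hasPn=> z Bz; have := hasPn hAB z Bz; rewrite /= mem_rev.
rewrite andbT has_cat negb_or hCA /=.
apply/hasPn=> z; rewrite memB in_setC => n1; rewrite /= memC in_setC negbK.
exact: triple_fix12 trip z n1.
Qed.

End NormalForm.

Lemma size_setC (T : finType) (l : seq T) (X : {set T}) :
  uniq l -> l =i ~: X -> size l = (#|T| - #|X|)%N.
Proof.
by move=> ul memX; rewrite -(card_uniqP ul) (eq_card memX) -(cardsC X) addKn.
Qed.

Lemma uniq_normal (T : finType) (o : T) A B C : uniq (o :: C ++ A ++ B) ->
  [/\ [/\ uniq A, uniq B & uniq C], uniq (o :: C ++ A) & uniq (o :: rev A ++ B)].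
Proof.
move=> ul; have u1 : uniq (o :: C ++ A).
  by move: ul; rewrite catA -cat_cons cat_uniq => /and3P[].
have u2 : uniq (o :: A ++ B).
  by move: ul; rewrite -cat1s uniq_catCA cat_uniq => /and3P[].
have u3 : uniq (o :: rev A ++ B).
  by rewrite (perm_uniq (s2 := o :: A ++ B)) // perm_cons perm_cat2r perm_rev.
split=> //; move: u1 u2; rewrite !cons_uniq !cat_uniq.
by case/andP=> _ /and3P[-> _ ->] /andP[_ /and3P[_ _ ->]].
Qed.

Lemma genus0_triple_conj (T : finType) (s1 s2 s3 t1 t2 t3 : {perm T}) :
    genus0_triple s1 s2 s3 -> genus0_triple t1 t2 t3 ->
    #|psupport s1| = #|psupport t1| -> #|psupport s2| = #|psupport t2| ->
    #|psupport s3| = #|psupport t3| ->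
  exists h : {perm T}, [/\ t1 ^ h = s1, t2 ^ h = s2 & t3 ^ h = s3].
Proof.
move=> trs trt e1 e2 e3.
have [o [A [B [C [ul [mA mB mC] _ E1 E2]]]]] := normal_form trs.
have [o' [A' [B' [C' [ul' [mA' mB' mC'] _ E1' E2']]]]] := normal_form trt.
have [[uA uB uC] u1 u2] := uniq_normal ul.
have [[uA' uB' uC'] u1' u2'] := uniq_normal ul'.
have sA : size A = size A' by rewrite (size_setC uA mA) (size_setC uA' mA') e3.
have sB : size B = size B' by rewrite (size_setC uB mB) (size_setC uB' mB') e1.
have sC : size C = size C' by rewrite (size_setC uC mC) (size_setC uC' mC') e2.
have [|h] := exists_map_perm ul ul'; first by rewrite /= !size_cat sA sB sC.
rewrite /= !map_cat => -[ho /eqP];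
  rewrite eqseq_cat ?size_map // => /andP[/eqP hC].
rewrite eqseq_cat ?size_map // => /andP[/eqP hA /eqP hB].
have h1 : t1 ^ h = s1 by apply: conj_next u1' E1 E1' _;
  rewrite /= map_cat ho hC hA.
have h2 : t2 ^ h = s2 by apply: conj_next u2' E2 E2' _;
  rewrite /= map_cat map_rev ho hB hA.
exists h; split=> //.
have inv3 (r1 r2 r3 : {perm T}) : genus0_triple r1 r2 r3 -> r3 = (r1 * r2)^-1.
  by case=> _ prod1 _ _; apply/esym/eqP; rewrite eq_invg_mul prod1.
by rewrite (inv3 _ _ _ trt) (inv3 _ _ _ trs) conjVg conjMg h1 h2.
Qed.

(** * Words in two of the three cycles *)

Section TripleGroup.

Variables (T : finType) (s1 s2 s3 : {perm T}).
Hypothesis trip : genus0_triple s1 s2 s3.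

(** The cycles commute at a point that is not last in its segment: inside [C] the second acts
    trivially, inside [B] the first does, and inside [A] they are mutually inverse. Only [o] and the
    ends of [C], [rev A] and [B] remain. *)
Lemma commg_triple_support : #|psupport [~ s1, s2]| <= 4.
Proof.
have [o [A [B [C [ul [mA mB mC] _ E1 E2]]]]] := normal_form trip.
have [[uA uB uC] u1 u2] := uniq_normal ul.
pose W := [set w | s2 (s1 w) != s1 (s2 w)].
have -> : psupport [~ s1, s2] = [set s1 (s2 w) | w in W].
  apply/setP=> z; rewrite -{1 2}(permKV (s2 * s1) z) permM.
  rewrite mem_imset; last by move=> u v /perm_inj/perm_inj.
  by rewrite !inE /commg /conjg !permM !permK.
apply: leq_trans (leq_imset_card _ _) _.
have back z : z \in A -> s2 (s1 z) = z.
  by rewrite mA in_setC; apply: triple_fix3 trip z.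
have fix1 z : z \in B -> s1 z = z by rewrite mB in_setC; apply: psupportN.
have fix2 z : z \in C -> s2 z = z by rewrite mC in_setC; apply: psupportN.
suff sub : W \subset [set:: [:: o; last o C; last o (rev A); last o B]].
  apply: leq_trans (subset_leq_card sub) _; rewrite cardsE; exact: card_size.
apply/subsetP=> w; rewrite !inE; apply: contraR;
  rewrite !negb_or => /and4P[wo wC wA wB].
have : w \in o :: C ++ A ++ B.
  have : #|T| <= size (o :: C ++ A ++ B).
    have [_ _ _ sum] := trip; rewrite /= !size_cat (size_setC uA mA)
      (size_setC uB mB) (size_setC uC mC).
    have := max_card (psupport s1); have := max_card (psupport s2);
      have := max_card (psupport s3).
    by move: sum; arith.
  by rewrite cardE => /(uniq_min_size ul)[//|_ ->]; rewrite ?mem_enum // => z;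
    rewrite mem_enum.
rewrite inE (negPf wo) !mem_cat /= => /or3P[Cw | Aw | Bw].
- rewrite (fix2 w Cw) fix2 // E1;
  exact: (@next_in_infix _ [:: o] C A w o u1 Cw wC).
- have rAw : w \in rev A by rewrite mem_rev.
  have A2 : s2 w \in A.
    by rewrite -mem_rev E2; exact:
      (@next_in_infix _ [:: o] (rev A) B w o u2 rAw wA).
  by rewrite back //; apply/eqP/(@perm_inj _ s2); rewrite (back (s2 w) A2).
have B2 : s2 w \in B.
  rewrite E2 -[_ ++ _]cats0 -catA;
    apply: (@next_in_infix _ (o :: rev A) B [::] w o) => //.
  by rewrite cats0.
by rewrite (fix1 w Bw) fix1.
Qed.

(** If [s1] and [s2] commuted, the support of [s1] would be stable under [s2]; but [s2] carries [o],
    which [s1] moves, to any point fixed by [s1]. *)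
Lemma triple_commg_neq1 : #|psupport s1| < #|T| -> [~ s1, s2] != 1.
Proof.
move=> ltT; have [o [A [B [C [ul [mA mB mC] [o1 o2 o3] E1 E2]]]]] :=
  normal_form trip.
have [b] : exists b, b \in ~: psupport s1.
  by apply/card_gt0P; have := cardsC (psupport s1); arith.
rewrite in_setC => nb; have nb' := nb; apply: contraNneq nb => com.
have [[_ [on2 orb2] _] _ _ _] := trip.
have b2 : b \in psupport s2 by apply: triple_fix12 trip b nb'.
move: b2; rewrite -(orb2 o o2) => /porbitP[i ->]; elim: i => [|i];
  first by rewrite perm1.
rewrite expgSr permM; set x := (s2 ^+ i) o; rewrite !inE;
  apply: contra => /eqP fx.
have /commgP/(congr1 (fun p : {perm T} => p x)) := introT eqP com;
  rewrite !permM fx.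
by move/perm_inj => ->.
Qed.

(* In degree 7 the word [s1 * s1 * s2^-1] has cycle type (3, 2, 2). *)
Lemma triple555_cycle3 :
    #|psupport s1| = 5 -> #|psupport s2| = 5 -> #|psupport s3| = 5 ->
  exists2 D : {set T}, #|D| = 3 & cycle_on D ((s1 * s1 * s2^-1) ^+ 2).
Proof.
move=> e1 e2 e3; have [o [A [B [C [ul [mA mB mC] _ E1 E2]]]]] := normal_form trip.
have [[uA uB uC] u1 u2] := uniq_normal ul.
have oT : #|T| = 7 by have [_ _ _] := trip; rewrite e1 e2 e3; lia.
have := size_setC uA mA; have := size_setC uB mB; have := size_setC uC mC.
rewrite e1 e2 e3 oT.
case: C => [|c1 [|c2 []]] // in ul mC E1 u1 uC * => _.
case: B => [|b1 [|b2 []]] // in ul mB E2 u2 uB * => _.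
case: A => [|a1 [|a2 []]] // in ul mA E1 E2 u1 u2 uA * => _.
have c1E : fcycle s1 [:: o; c1; c2; a1; a2].
  by rewrite (eq_cycle (e' := frel (next [:: o; c1; c2; a1; a2]))) ?cycle_next
    // => x y /=; rewrite E1.
have c2E : fcycle s2 [:: o; a2; a1; b1; b2].
  by rewrite (eq_cycle (e' := frel (next [:: o; a2; a1; b1; b2]))) ?cycle_next
    // => x y /=; rewrite E2.
move: c1E; rewrite /= => /and5P[/eqP so /eqP sc1 /eqP sc2 /eqP sa1
  /andP[/eqP sa2 _]].
move: c2E; rewrite /= => /and5P[/eqP to /eqP ta2 /eqP ta1 /eqP tb1
  /andP[/eqP tb2 _]].
have fixs x : x \in [:: b1; b2] -> s1 x = x by rewrite mB in_setC;
  apply: psupportN.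
have fixt x : x \in [:: c1; c2] -> s2 x = x by rewrite mC in_setC;
  apply: psupportN.
have [sb1 sb2] : s1 b1 = b1 /\ s1 b2 = b2 by split; apply: fixs;
  rewrite !inE eqxx ?orbT.
have [tc1 tc2] : s2 c1 = c1 /\ s2 c2 = c2 by split; apply: fixt;
  rewrite !inE eqxx ?orbT.
set w := s1 * s1 * s2^-1.
have wE x y z : s1 x = y -> s1 y = s2 z -> w x = z.
  by move=> sx sy; rewrite /w !permM sx sy permK.
have wo : w o = c2 by apply: (wE _ _ _ so); rewrite tc2.
have wc2 : w c2 = o by apply: (wE _ _ _ sc2); rewrite sa1 to.
have wc1 : w c1 = a2 by apply: (wE _ _ _ sc1); rewrite sc2 ta2.
have wa2 : w a2 = c1 by apply: (wE _ _ _ sa2); rewrite so tc1.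
have wa1 : w a1 = b2 by apply: (wE _ _ _ sa1); rewrite sa2 tb2.
have wb1 : w b1 = a1 by apply: (wE _ _ _ sb1); rewrite sb1 ta1.
have wb2 : w b2 = b1 by apply: (wE _ _ _ sb2); rewrite sb2 tb1.
have w2 x : (w ^+ 2) x = w (w x) by rewrite expgS expg1 permM.
have memT x : x \in [:: o; c1; c2; a1; a2; b1; b2].
  by have := @uniq_min_size _ _ (enum T) ul;
    rewrite -cardE oT => /(_ _ isT)[|_ ->]; rewrite ?mem_enum // => z;
      rewrite mem_enum.
exists [set a1; b1; b2].
  move: ul => /=; rewrite !inE !negb_or -!andbA.
  do ![case/andP=> ?]; move=> *; apply: cards3 => //.
apply: cycle_on3; rewrite ?w2 ?wa1 ?wb1 ?wb2 //.
apply/subsetP=> z; rewrite inE w2; apply: contraR => nD.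
move: (memT z) nD; rewrite !inE =>
  /or4P[/eqP-> | /eqP-> | /eqP-> | /or4P[]/eqP->].
- by rewrite wo wc2.
- by rewrite wc1 wa2.
- by rewrite wc2 wo.
- by rewrite eqxx.
- by rewrite wa2 wc1.
- by rewrite eqxx orbT.
- by rewrite eqxx orbT.
Qed.
End TripleGroup.

Lemma cycle_on_ntrans (T : finType) (G : {group {perm T}}) s k :
    [primitive G, on [set: T] | 'P] -> s \in G -> cycle_on (psupport s) s ->
    1 < #|psupport s| -> #|psupport s| + k < #|T| ->
  [transitive^k.+2 G, on [set: T] | 'P].
Proof.
move=> primG Gs cyc lt1 ltT.
have := primitive_cycle_ntrans primG Gs cyc (subsetT _); rewrite cardsT => H.
by apply: ntransitive_weak (H _); arith.
Qed.

Lemma triple_meet (T : finType) (s1 s2 s3 : {perm T}) :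
    genus0_triple s1 s2 s3 -> #|psupport s3| = #|T| ->
  exists o, psupport s1 :&: psupport s2 = [set o].
Proof.
move=> trip e3; have [o Io] := triple_point trip; exists o; rewrite -Io.
have -> : psupport s3 = setT by apply/eqP;
  rewrite eqEcard subsetT cardsT e3 leqnn.
by rewrite setIT.
Qed.

Lemma triple_cycle3 (T : finType) (G : {group {perm T}}) (s1 s2 s3 : {perm T}) :
    genus0_triple s1 s2 s3 -> [primitive G, on [set: T] | 'P] ->
    s1 \in G -> s2 \in G -> s3 \in G ->
    1 < #|psupport s1| -> 1 < #|psupport s2| -> 1 < #|psupport s3| ->
    ~ perm_eq [:: #|psupport s1|; #|psupport s2|; #|psupport s3|] [:: 4; 4; 5] ->
  exists c (D : {set T}), [/\ c \in G, #|D| = 3 & cycle_on D c].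
Proof.
move=> trip primG G1 G2 G3 lt1 lt2 lt3 not445.
have [[cyc1 cyc2 cyc3] _ _ sum] := trip.
have m1 := max_card (psupport s1); have m2 := max_card (psupport s2).
have m3 := max_card (psupport s3).
have trip' := genus0_triple_rot trip; have trip'' := genus0_triple_rot trip'.
have comm (u v : {perm T}) : u \in G -> v \in G ->
    (exists o, psupport u :&: psupport v = [set o]) ->
    exists c (D : {set T}), [/\ c \in G, #|D| = 3 & cycle_on D c].
  move=> Gu Gv [o /commg_cycle3[D oD cD]].
  by exists [~ u, v], D; split=> //; rewrite groupR.
have [e1 | ne1] := eqVneq #|psupport s1| #|T|.
  exact: comm G2 G3 (triple_meet trip' e1).
have [e2 | ne2] := eqVneq #|psupport s2| #|T|.
  exact: comm G3 G1 (triple_meet trip'' e2).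
have [e3 | ne3] := eqVneq #|psupport s3| #|T|.
  exact: comm G1 G2 (triple_meet trip e3).
have [eq3 | n31] := eqVneq #|psupport s1| 3; first by exists s1, (psupport s1).
have [eq3 | n32] := eqVneq #|psupport s2| 3; first by exists s2, (psupport s2).
have [eq3 | n33] := eqVneq #|psupport s3| 3; first by exists s3, (psupport s3).
have high s : s \in G -> cycle_on (psupport s) s -> 1 < #|psupport s| ->
    #|psupport s| + 2 < #|T| -> 6 < #|T| ->
    exists c (D : {set T}), [/\ c \in G, #|D| = 3 & cycle_on D c].
  move=> Gs cyc lts ltT T6; have tr4 := cycle_on_ntrans primG Gs cyc lts ltT.
  have c4 := commg_triple_support trip.
  apply: (transitive_cycle3 tr4 (t := [~ s1, s2])) => //.
  - by rewrite groupR.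
  - by apply: (triple_commg_neq1 trip); rewrite ltn_neqAle ne1.
  - by arith.
(* A length 2 would force another cycle to move every point, so all lengths are now at least 4.
   Their sum [2 * #|T| + 1] then gives degree 6 and the excluded lengths 4, 4, 5. *)
have [T6 | T6] := ltnP 6 #|T|; last first.
  case: not445; move: sum ne1 ne2 ne3 n31 n32 n33 m1 m2 m3 T6 lt1 lt2 lt3.
  move: #|psupport s1| #|psupport s2| #|psupport s3| #|T| => a b c d; clear.
  move=> sum ne1 ne2 ne3 n31 n32 n33 m1 m2 m3 T6 lt1 lt2 lt3.
  have : [\/ [/\ a = 4, b = 4 & c = 5], [/\ a = 4, b = 5 & c = 4] |
    [/\ a = 5, b = 4 & c = 4]].
    have d6 : d = 6 by lia.
    subst d; have [a4|a5] : a = 4 \/ a = 5 by lia.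
      have [b4|b5] : b = 4 \/ b = 5 by lia.
        by apply: Or31; split=> //; lia.
      by apply: Or32; split=> //; lia.
    by apply: Or33; split; lia.
  by case=> [[-> -> ->]|[-> -> ->]|[-> -> ->]].
have [l1|g1] := ltnP (#|psupport s1| + 2) #|T|; first exact: (high s1).
have [l2|g2] := ltnP (#|psupport s2| + 2) #|T|; first exact: (high s2).
have [l3|g3] := ltnP (#|psupport s3| + 2) #|T|; first exact: (high s3).
(* No cycle has three fixed points, so [3 * (#|T| - 2) <= 2 * #|T| + 1]; thus the degree is 7 and
   all lengths are 5. Two fixed points give only 3-transitivity, too little to move a support of
   four points, hence the special word. *)
have [e1 e2 e3] : [/\ #|psupport s1| = 5, #|psupport s2| = 5 & #|psupport s3| =
  5].
  by split; arith.
have [D oD cD] := triple555_cycle3 trip e1 e2 e3.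
by exists ((s1 * s1 * s2^-1) ^+ 2), D; split=> //;
  rewrite groupX // !groupM ?groupV.
Qed.

(** * The case (4, 4, 5) *)

(* The colour of the edge ij in a one-factorization of K_6 preserved, up to a
   permutation of the colours, by (0 1 2 3) and (0 3 4 5). The final [%% 5] only
   makes the bound hold for all i and j. *)
Definition k6_colour (i j : nat) : nat :=
  nth 0%N (nth [::] [:: [:: 0; 0; 1; 2; 3; 4]; [:: 0; 0; 3; 1; 4; 2];
    [:: 1; 3; 0; 4; 2; 0]; [:: 2; 1; 4; 0; 0; 3]; [:: 3; 4; 2; 0; 0; 1];
    [:: 4; 2; 0; 3; 1; 0]] i)%N j %% 5.

Lemma k6_colour_lt i j : k6_colour i j < 5.
Proof. by rewrite ltn_mod. Qed.

Definition k6_preserves (l : seq nat) :=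
  all (fun i => all (fun j => (i == j) ||
    (k6_colour (nth 0 l i) (nth 0 l j) == k6_colour i j)) (iota 0 6)) (iota 0 6).

(** A check of all 720 permutations; it makes the action on the five colours faithful. *)
Lemma k6_rigid : all (fun l => k6_preserves l ==> (l == iota 0 6))
  (permutations (iota 0 6)).
Proof. by vm_compute. Qed.

Definition k6_maps (l m : seq nat) :=
  all (fun i => all (fun j => (i == j) ||
    (k6_colour (nth 0 l i) (nth 0 l j) == nth 0 m (k6_colour i j))) (iota 0 6))
      (iota 0 6).

Lemma k6_maps1 : k6_maps [:: 1; 2; 3; 0; 4; 5]%N [:: 3; 1; 0; 4; 2]%N.
Proof. by vm_compute. Qed.

Lemma k6_maps2 : k6_maps [:: 3; 1; 2; 4; 5; 0]%N [:: 1; 4; 0; 3; 2]%N.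
Proof. by vm_compute. Qed.

Section Colouring.

Variables (T : finType) (L : seq T).
Hypotheses (uL : uniq L) (sL : size L = 6) (mL : forall x, x \in L).

Definition colour (x y : T) :
  'I_5 := Ordinal (k6_colour_lt (index x L) (index y L)).

(** The graph of the action on colours. As a subgroup of the direct product it has both projections
    as morphisms, and no colour permutation need be computed from a point permutation. *)
Definition colour_group_set : {set {perm T} * {perm 'I_5}} :=
  [set u : {perm T} * {perm 'I_5} |
    [forall x, forall y, (x != y) ==>
      (colour (u.1 x) (u.1 y) == u.2 (colour x y))]].

Lemma colour_groupP (u : {perm T} * {perm 'I_5}) :
  reflect (forall x y, x != y -> colour (u.1 x) (u.1 y) = u.2 (colour x y))
  (u \in colour_group_set).
Proof.
rewrite inE; apply: (iffP forallP) => [cu x y neq | cu x].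
  by have /forallP/(_ y)/implyP/(_ neq)/eqP := cu x.
by apply/forallP=> y; apply/implyP=> neq; rewrite cu.
Qed.

Lemma colour_group_set_group : group_set colour_group_set.
Proof.
apply/group_setP; split=> [|u v /colour_groupP cu /colour_groupP cv].
  by apply/colour_groupP=> x y _; rewrite !perm1.
apply/colour_groupP=> x y neq; rewrite !permM cv ?cu //.
by rewrite (inj_eq perm_inj).
Qed.

Canonical colour_group := Group colour_group_set_group.

Lemma index_lt x : index x L < 6.
Proof. by rewrite -sL index_mem mL. Qed.

Lemma index_injL : injective (fun x => index x L).
Proof. by move=> x y eqi; rewrite -(nth_index x (mL x)) eqi nth_index. Qed.

Lemma colour_fst_inj u : u \in colour_group -> u.1 = 1 -> u = 1.
Proof.
move=> /colour_groupP; case: u => p q /= cu p1; congr (_, _) => //.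
have [x0 _] : exists x, x \in T.
  by case: (L) sL => [//|x l _]; exists x.
apply/permP=> k; rewrite perm1.
(* Row 0 of the table is arranged so that the edge from point 0 to point [k.+1] has colour [k];
   every colour is therefore seen at point 0. *)
have lk : k.+1 < 6 by rewrite ltnS.
have neq : nth x0 L 0 != nth x0 L k.+1 by rewrite nth_uniq ?sL.
have := cu _ _ neq; rewrite p1 !perm1.
suff -> : colour (nth x0 L 0) (nth x0 L k.+1) = k by [].
by apply: val_inj; rewrite /= !index_uniq ?sL //;
  case: k {lk neq} => [[|[|[|[|[|k]]]]]].
Qed.

Lemma colour_snd_inj u : u \in colour_group -> u.2 = 1 -> u = 1.
Proof.
move=> /colour_groupP; case: u => p q /= cu q1; congr (_, _) => //.
have [x0 _] : exists x, x \in T.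
  by case: (L) sL => [//|x l _]; exists x.
pose f i := index (p (nth x0 L i)) L.
have fE i : i < 6 -> nth 0 (mkseq f 6) i = f i by move=> lti; rewrite nth_mkseq.
have pf : mkseq f 6 \in permutations (iota 0 6).
  have um : uniq (mkseq f 6).
    rewrite map_inj_in_uniq ?iota_uniq // => i j.
    rewrite !mem_iota !add0n => /andP[_ li] /andP[_ lj].
    by move/index_injL/perm_inj/eqP; rewrite nth_uniq ?sL // => /eqP.
  have sub : {subset mkseq f 6 <= iota 0 6}.
    by move=> _ /mapP[i _ ->]; rewrite mem_iota /= index_lt.
  rewrite mem_permutations; apply: uniq_perm; rewrite ?iota_uniq //.
  by have [|_ eqi] := uniq_min_size um sub; rewrite ?size_mkseq ?size_iota.
have /eqP eqf : mkseq f 6 == iota 0 6.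
  apply: (implyP (allP k6_rigid _ pf)).
  apply/allP=> i; rewrite mem_iota add0n => /andP[_ li].
  apply/allP=> j; rewrite mem_iota add0n => /andP[_ lj].
  have [//|neq] /= := eqVneq i j; rewrite !fE //.
  have neqx : nth x0 L i != nth x0 L j by rewrite nth_uniq ?sL.
  have := congr1 val (cu _ _ neqx); rewrite q1 perm1 /= !index_uniq ?sL //.
  by move->.
apply/permP=> x; rewrite perm1; apply: index_injL.
have := fE _ (index_lt x); rewrite eqf nth_iota ?index_lt // /f nth_index ?mL //.
Qed.

Lemma colour_lift (p : {perm T}) (l m : seq nat) x0 :
    k6_maps l m -> size l = 6 -> uniq m -> size m = 5 -> all (gtn 5) m ->
      all (gtn 6) l ->
    (forall i, i < 6 -> p (nth x0 L i) = nth x0 L (nth 0 l i)) ->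
  exists q, (p, q) \in colour_group.
Proof.
move=> mp sl um sm lm ll pE.
have ltm (k : 'I_5) : nth 0 m k < 5 by apply: (allP lm); rewrite mem_nth // sm.
have injm : injective (fun k : 'I_5 => Ordinal (ltm k)).
  by move=> i j /(congr1 val)/= /eqP; rewrite nth_uniq ?sm // => /eqP/val_inj.
exists (perm injm); apply/colour_groupP=> x y neq; apply: val_inj;
  rewrite permE /=.
have ltl i : i < 6 -> nth 0 l i < 6 by move=> li; apply: (allP ll);
  rewrite mem_nth ?sl.
rewrite -{1}(nth_index x0 (mL x)) -{1}(nth_index x0 (mL y)) !pE ?index_lt //.
rewrite !index_uniq ?sL ?ltl ?index_lt //.
have := allP mp (index x L);
  rewrite mem_iota index_lt => /(_ isT)/allP/(_ (index y L)).
rewrite mem_iota index_lt => /(_ isT)/orP[/eqP/index_injL eqxy|/eqP->//].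
by rewrite eqxy eqxx in neq.
Qed.

End Colouring.

(** Orbit-stabiliser twice; the stabiliser of both points contains [<[s]>]. *)
Lemma trans2_card (T : finType) (G : {group {perm T}}) s x y :
    [transitive^2 G, on [set: T] | 'P] -> x != y -> s \in G -> s x = x ->
      s y = y ->
  (#|T| * (#|T| - 1) * #[s] <= #|G|)%N.
Proof.
move=> tr2 neq Gs sx sy; have trG := ntransitive1 (isT : 0 < 2) tr2.
have trGx : [transitive 'C_G[x | 'P], on [set: T] :\ x | 'P].
  by apply: (@ntransitive1 _ _ _ _ _ 1) => //; apply: stab_ntransitive.
rewrite -(card_orbit_stab 'P G x) (atransP trG) ?in_setT // cardsT -mulnA
  leq_mul2l.
apply/orP; right.
rewrite -(card_orbit_stab 'P 'C_G[x | 'P]%G y) (atransP trGx) ?inE 1?eq_sym ?neq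
  //.
have -> : #|[set: T] :\ x| = (#|T| - 1)%N
  by rewrite cardsDS ?subsetT // cardsT cards1.
rewrite leq_mul2l; apply/orP; right; apply: subset_leq_card.
rewrite cycle_subG !inE Gs /=; apply/andP; split; rewrite sub1set inE; exact/eqP.
Qed.

Lemma card_porbit_order (T : finType) (s : {perm T}) x : #|porbit s x| <= #[s].
Proof. by rewrite porbit.unlock; apply: leq_imset_card. Qed.

(** A squeeze: [G] lies in the image of the colour group, which embeds in the symmetric group on
    five colours, while 2-transitivity and the 4-cycle [s1], which fixes two points, give
    [#|G| >= 6 * 5 * 4 = 120]. All inclusions are equalities. *)
Lemma triple445_isog (T : finType) (G : {group {perm T}}) (s1 s2 s3 : {perm T}) :
    genus0_triple s1 s2 s3 ->
    #|psupport s1| = 4 -> #|psupport s2| = 4 -> #|psupport s3| = 5 ->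
    s1 \in G -> G \subset <<[set s1; s2]>> ->
      [transitive^2 G, on [set: T] | 'P] ->
  G \isog 'Sym_('I_5).
Proof.
move=> trip e1 e2 e3 Gs1 sG tr2.
have [[cyc1 _ _] _ _ sum] := trip.
have [o [A [B [C [ul [mA mB mC] [o1 _ _] E1 E2]]]]] := normal_form trip.
have [[uA uB uC] u1 u2] := uniq_normal ul.
have oT : #|T| = 6 by move: sum; rewrite e1 e2 e3; lia.
have := size_setC uA mA; have := size_setC uB mB; have := size_setC uC mC.
rewrite e1 e2 e3 oT.
case: C => [|c1 [|c2 []]] // in ul mC E1 u1 uC * => _.
case: B => [|b1 [|b2 []]] // in ul mB E2 u2 uB * => _.
case: A => [|a []] // in ul mA E1 E2 u1 u2 uA * => _.
(* In the order [o, c1, c2, a, b1, b2] the cycles [s1] and [s2] become (0 1 2 3) and (0 3 4 5), as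
   in [k6_maps1] and [k6_maps2]. *)
set L := (o :: _) in ul.
have mL x : x \in L.
  by have [||_ ->] := @uniq_min_size _ L (enum T) ul;
    rewrite ?mem_enum // -?cardE ?oT // => z; rewrite mem_enum.
have sL : size L = 6 by [].
have fixs x : x \in [:: b1; b2] -> s1 x = x by rewrite mB in_setC;
  apply: psupportN.
have fixt x : x \in [:: c1; c2] -> s2 x = x by rewrite mC in_setC;
  apply: psupportN.
have c1E : fcycle s1 [:: o; c1; c2; a].
  by rewrite (eq_cycle (e' := frel (next [:: o; c1; c2; a]))) ?cycle_next // =>
    x y /=; rewrite E1.
have c2E : fcycle s2 [:: o; a; b1; b2].
  by rewrite (eq_cycle (e' := frel (next [:: o; a; b1; b2]))) ?cycle_next // =>
    x y /=; rewrite E2.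
move: c1E; rewrite /= => /and5P[/eqP so /eqP sc1 /eqP sc2 /eqP sa _].
move: c2E; rewrite /= => /and5P[/eqP to /eqP ta /eqP tb1 /eqP tb2 _].
have [sb1 sb2] : s1 b1 = b1 /\ s1 b2 = b2 by split; apply: fixs;
  rewrite !inE eqxx ?orbT.
have [tc1 tc2] : s2 c1 = c1 /\ s2 c2 = c2 by split; apply: fixt;
  rewrite !inE eqxx ?orbT.
pose H := colour_group L.
have idx i : i < 6 -> [\/ i = 0, i = 1, i = 2 | [\/ i = 3, i = 4 | i = 5]]%N.
  by move=> lti; do 6 (case: i lti => [|i] lti; first by constructor=> //;
    constructor).
have [q1 Hq1] : exists q, (s1, q) \in H.
  apply: (colour_lift ul sL mL (x0 := o) k6_maps1) => // i /idx.
  by case=> [->|->|->|[]->].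
have [q2 Hq2] : exists q, (s2, q) \in H.
  apply: (colour_lift ul sL mL (x0 := o) k6_maps2) => // i /idx.
  by case=> [->|->|->|[]->].
pose f1 := restrm_morphism (subsetT H) (@fst_morphism _ _).
pose f2 := restrm_morphism (subsetT H) (@snd_morphism _ _).
have inj1 : 'injm f1.
  apply/subsetP=> u; rewrite ker_restrm => /setIP[Hu /mker/= v1].
  by rewrite inE (colour_fst_inj ul sL Hu v1).
have inj2 : 'injm f2.
  apply/subsetP=> u; rewrite ker_restrm => /setIP[Hu /mker/= v2].
  by rewrite inE (colour_snd_inj ul sL mL Hu v2).
have sGH : G \subset f1 @* H.
  apply: subset_trans sG _; rewrite gen_subG; apply/subsetP=> p.
  by rewrite !inE => /orP[]/eqP->; apply/morphimP;
    [exists (s1, q1) | exists (s2, q2)].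
have leG : 120 <= #|G|.
  have neqb : b1 != b2 by move: uB; rewrite /= inE andbT.
  have := trans2_card tr2 neqb Gs1 sb1 sb2; rewrite oT; apply: leq_trans.
  rewrite -[120]/(6 * (6 - 1) * 4)%N leq_mul2l orFb -e1
    -[psupport s1](proj2 cyc1 o) //.
  exact: card_porbit_order.
have o1H : #|f1 @* H| = #|H| := card_injm inj1 (subxx H).
have o2H : #|f2 @* H| = #|H| := card_injm inj2 (subxx H).
have oS5 : #|[set: {perm 'I_5}]| = 120 by rewrite (card_Sym 'I_5) card_ord.
have leH : #|H| <= 120 by rewrite -o2H -oS5 subset_leq_card ?subsetT.
have -> : G = f1 @* H :> {set _}.
  by apply/eqP; rewrite eqEcard sGH o1H (leq_trans leH).
have -> : 'Sym_('I_5) = f2 @* H.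
  apply/esym/eqP; rewrite eqEcard subsetT oS5 o2H -o1H.
  exact: leq_trans leG (subset_leq_card sGH).
apply: isog_trans (sub_isog (subxx H) inj2).
by rewrite isog_sym; apply: sub_isog.
Qed.

(** * Hurwitz factorizations *)

Lemma is_ecycle_cycle_on d e (s : 'S_d) : 1 < e -> is_ecycle e s ->
  cycle_on (psupport s) s /\ #|psupport s| = e.
Proof.
move=> lt1e [x oD onD].
have cyc : cycle_on (porbit s x) s.
  by split=> // y; rewrite -eq_porbit_mem => /eqP.
by rewrite (cycle_on_support _ cyc) ?oD.
Qed.

Lemma hurwitz_seq d r (e : r.-tuple nat) (sigma : r.-tuple 'S_d) :
    (forall i, 1 < tnth e i) -> hurwitz_factorization e sigma ->
  [/\ forall p, p \in tval sigma -> cycle_on (psupport p) p,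
      e = [tuple of map (fun s : 'S_d => #|psupport s|) sigma],
      \prod_(p <- sigma) p = 1 &
      [transitive hurwitz_group sigma, on [set: 'I_d] | 'P]].
Proof.
move=> gt1 [cyc prod1 trG]; split=> //.
- by move=> p /tnthP[i ->]; have [] := is_ecycle_cycle_on (gt1 i) (cyc i).
- apply: eq_from_tnth => i; rewrite tnth_map.
  by have [_ ->] := is_ecycle_cycle_on (gt1 i) (cyc i).
by rewrite big_tuple.
Qed.

Lemma cycle_on_conj (T : finType) (D D' : {set T}) (s s' : {perm T}) :
    cycle_on D s -> cycle_on D' s' -> #|D| = #|D'| -> 0 < #|D| ->
  exists h : {perm T}, s' ^ h = s.
Proof.
move=> cyc cyc' eqD D0; have [x Dx] : exists x, x \in D by apply/card_gt0P.
have [y Dy] : exists x, x \in D' by apply/card_gt0P; rewrite -eqD.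
have [ul El _ _] := cycle_on_next cyc Dx.
have [ul' El' _ _] := cycle_on_next cyc' Dy.
have [|h eqh] := exists_map_perm ul ul'; first by rewrite /= !size_traject eqD.
by exists h; apply: conj_next ul' El El' eqh.
Qed.

Lemma odd_cycle_on (T : finType) (D : {set T}) (s : {perm T}) :
  cycle_on D s -> 0 < #|D| -> s = ~~ odd #|D| :> bool.
Proof.
move=> [onD orbD] D0; have [x Dx] : exists x, x \in D by apply/card_gt0P.
have := @card_porbits_cycle _ s x;
  rewrite orbD // => /(_ (fun z => @out_perm _ _ _ z onD)) ocard.
by have := congr1 odd ocard; rewrite oddD /= /odd_perm; do 3!case: (odd _).
Qed.

Lemma genus0_triple_of (T : finType) (s1 s2 s3 : {perm T}) :
    {in [:: s1; s2; s3], forall p, cycle_on (psupport p) p} ->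
    {in [:: s1; s2; s3], forall p, 1 < #|psupport p|} ->
    \prod_(p <- [:: s1; s2; s3]) p = 1 ->
    [transitive <<[set:: [:: s1; s2; s3]]>>, on [set: T] | 'P] ->
    (\sum_(p <- [:: s1; s2; s3]) (#|psupport p| - 1) = 2 * #|T| - 2)%N ->
  genus0_triple s1 s2 s3.
Proof.
move=> cyc gt1; rewrite !big_cons !big_nil mulg1 mulgA => prod1 trG sum.
have g1 := gt1 s1; have g2 := gt1 s2; have g3 := gt1 s3.
rewrite !inE !eqxx ?orbT in g1 g2 g3.
have {}g1 := g1 isT; have {}g2 := g2 isT; have {}g3 := g3 isT.
split=> //.
- by split; apply: cyc; rewrite !inE eqxx ?orbT.
- apply/setP=> x; rewrite !in_setU in_setT; apply/negPn/negP.
  rewrite !negb_or -andbA => /and3P[n1 n2 n3].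
  have [y neq] : exists y, y != x.
    have /card_gt1P[u [v [_ _ uv]]] : 1 < #|T|
      by have := max_card (psupport s1); arith.
    by have [eqx | ] := eqVneq u x; [exists v; rewrite eq_sym -eqx | exists u].
  have [h Gh hx] := atransP2 trG (in_setT x) (in_setT y).
  have : h \in 'C[x | 'P].
    move: h Gh {hx}; apply/subsetP; rewrite gen_subG; apply/subsetP=> p.
    rewrite inE => ps_p; apply/astab1P/psupportN.
    by move: ps_p; rewrite in_cons mem_seq2 => /or3P[]/eqP->.
  by move/astab1P=> fx; rewrite hx fx eqxx in neq.
have := max_card (psupport s1); arith.
Qed.

Section Genus0Group.

Variables (T : finType) (ps : seq {perm T}).
Hypotheses (cyc : {in ps, forall p, cycle_on (psupport p) p})
  (gt1 : {in ps, forall p, 1 < #|psupport p|}) (prod1 : \prod_(p <- ps) p = 1)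
  (trG : [transitive <<[set:: ps]>>, on [set: T] | 'P])
  (genus0 : (\sum_(p <- ps) (#|psupport p| - 1) = 2 * #|T| - 2)%N)
  (lt2r : 2 < size ps).

Local Notation G := <<[set:: ps]>>%G.

Lemma mem_genG p : p \in ps -> p \in G.
Proof. by move=> ps_p; apply: mem_gen; rewrite inE. Qed.

(** For at least four cycles, the shortest length e satisfies [4 * (e - 1) <= 2 * #|T| - 2], that is
    [2 * e <= #|T| + 1]. This one bound yields both the e-transitivity and the room that
    [transitive_cycle3] asks for. *)
Lemma genus0_Alt :
    ~ (size ps = 3 /\ perm_eq [seq #|psupport p| | p : {perm T} <- ps]
      [:: 4; 4; 5]) ->
  'Alt_T \subset G.
Proof.
move=> not445; have primG := genus0_primitive cyc gt1 prod1 trG genus0 lt2r.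
suff [c [D [Gc oD cD]]] : exists c (D : {set T}),
  [/\ c \in G, #|D| = 3 & cycle_on D c].
  exact: primitive_cycle3_Alt primG Gc oD cD.
have [eq3 | neq3] := eqVneq (size ps) 3.
  case: ps eq3 cyc gt1 prod1 trG genus0 primG not445 (mem_genG) =>
    [|s1 [|s2 [|s3 []]]] //.
  move=> _ cyc' gt1' prod1' trG' genus0' primG not445 memG.
  have trip := genus0_triple_of cyc' gt1' prod1' trG' genus0'.
  by apply: (triple_cycle3 trip primG);
    rewrite ?memG ?gt1' ?inE ?eqxx ?orbT // => /(conj (erefl _))/not445.
have r4 : 3 < size ps by rewrite ltn_neqAle eq_sym neq3.
have [p ps_p minp] : exists2 p, p \in ps &
  {in ps, forall q, #|psupport p| <= #|psupport q|}.
  have exn : exists n, has (fun p : {perm T} => #|psupport p| == n) ps.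
    case: ps lt2r => // p l _; exists #|psupport p|; apply/hasP; exists p;
      rewrite ?mem_head //.
  case: (ex_minnP exn) => n /hasP[p ps_p /eqP op] minn.
  by exists p => // q ps_q; rewrite op; apply: minn; apply/hasP; exists q.
have bound : ((size ps) * (#|psupport p| - 1) <= 2 * #|T| - 2)%N.
  rewrite -genus0 -sum1_size big_distrl /= big_seq [leqRHS]big_seq.
  by apply: leq_sum => q ps_q; rewrite mul1n leq_sub2r // minp.
have gt1p := gt1 ps_p.
have le2 : (2 * #|psupport p| <= #|T|.+1)%N.
  move: bound r4 gt1p; move: (size ps) #|psupport p| #|T| => r e d; clear.
  by move=> b r4 e1; have : (4 * (e - 1) <= r * (e - 1))%N;
    [rewrite leq_mul2r r4 orbT | lia].
have tr := cycle_on_ntrans primG (mem_genG ps_p) (cyc ps_p) gt1p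
  (k := #|psupport p| - 2).
have {}tr : [transitive^(#|psupport p|) G, on [set: T] | 'P].
  by rewrite -[#|psupport p|](subnK gt1p) addn2; apply: tr; arith.
apply: (transitive_cycle3 tr (mem_genG ps_p)) => //.
apply: contraTneq gt1p => ->; rewrite (_ : psupport 1 = set0) ?cards0 //.
by apply/setP=> z; rewrite !inE perm1 eqxx.
Qed.

Lemma genus0_group_eq : 'Alt_T \subset G ->
  (all (fun p : {perm T} => odd #|psupport p|) ps ->
    G = 'Alt_T :> {set {perm T}}) /\
  (~~ all (fun p : {perm T} => odd #|psupport p|) ps ->
    G = 'Sym_T :> {set {perm T}}).
Proof.
move=> sAG.
have oddE p : p \in ps -> p = ~~ odd #|psupport p| :> bool.
  by move=> ps_p; apply: odd_cycle_on (cyc ps_p) _; apply: ltnW (gt1 ps_p).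
split=> [/allP all_odd | /allPn[q ps_q even_q]].
  apply/eqP; rewrite eqEsubset sAG andbT gen_subG; apply/subsetP=> p;
    rewrite inE => ps_p.
  by rewrite Alt_even oddE // all_odd.
apply/eqP; rewrite eqEsubset subsetT; apply/subsetP=> s _.
have GA (t : {perm T}) : ~~ t -> t \in G by move=> even_t; apply: (subsetP sAG);
  rewrite Alt_even.
have [odd_s | even_s] := boolP (odd_perm s); last exact: GA.
rewrite -[s](mulgKV q) (groupMr _ (mem_genG ps_q)); apply: GA.
by rewrite odd_permM odd_permV odd_s oddE ?even_q.
Qed.

End Genus0Group.

Lemma hurwitz_groupJ d r (sigma sigma' : r.-tuple 'S_d) (tau : 'S_d) :
    (forall i, tnth sigma' i ^ tau = tnth sigma i) ->
  hurwitz_group sigma' :^ tau = hurwitz_group sigma /\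
  (forall i, tnth sigma' i ^ tau \in tnth sigma i ^: hurwitz_group sigma).
Proof.
move=> conj_tau; split=> [|i]; last by rewrite conj_tau class_refl.
rewrite /= -genJ; congr <<_>>; apply/setP=> p; rewrite mem_conjg !inE.
apply/tnthP/tnthP=> -[i eqp]; exists i.
  by rewrite -conj_tau -eqp conjgKV.
by rewrite eqp -conj_tau conjgK.
Qed.

Lemma triple_gen_sub (T : finType) (s1 s2 s3 : {perm T}) (A : {set {perm T}}) :
    genus0_triple s1 s2 s3 -> {subset A <= [:: s1; s2; s3]} ->
  <<A>> \subset <<[set s1; s2]>>.
Proof.
case=> _ prod1 _ _ subA; rewrite gen_subG; apply/subsetP=> p /subA.
have [G1 G2] : s1 \in <<[set s1; s2]>> /\ s2 \in <<[set s1; s2]>>.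
  by split; rewrite mem_gen // !inE eqxx ?orbT.
rewrite in_cons mem_seq2 => /or3P[] /eqP-> //.
have -> : s3 = (s1 * s2)^-1 by apply/esym/eqP; rewrite eq_invg_mul prod1.
by rewrite groupV groupM.
Qed.

Lemma exists_fixed2 (T : finType) (s : {perm T}) : #|psupport s| + 2 <= #|T| ->
  exists u v, [/\ u != v, s u = u & s v = v].
Proof.
move=> le2; have /card_gt1P[u [v [nu nv neq]]] : 1 < #|~: psupport s|.
  by have := cardsC (psupport s); arith.
by exists u, v; split; rewrite // psupportN // -in_setC.
Qed.

(** The transposition of two fixed points of [s] commutes with [s], so it can be put in front of [k]
    to correct the sign. *)
Lemma class_Alt (T : finType) (s t k : {perm T}) :
  #|psupport s| + 2 <= #|T| -> s ^ k = t -> t \in s ^: 'Alt_T.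
Proof.
move=> /exists_fixed2[u [v [neq su sv]]] <-.
have [odd_k | even_k] := boolP (odd_perm k);
  last by rewrite memJ_class // Alt_even.
have com : commute (tperm u v) s.
  by apply/commgP/conjg_fixP; rewrite tpermJ su sv.
have <- : s ^ (tperm u v * k) = s ^ k
  by rewrite conjgM [s ^ tperm u v]conjgE -com mulKg.
by rewrite memJ_class // Alt_even odd_permM odd_tperm neq odd_k.
Qed.

Lemma seq_size2 (A : Type) (s : seq A) : size s = 2 -> exists a b, s = [:: a; b].
Proof. by case: s => [|a [|b []]] // _; exists a, b. Qed.

Lemma seq_size3 (A : Type) (s : seq A) :
  size s = 3 -> exists a b c, s = [:: a; b; c].
Proof. by case: s => [|a [|b [|c []]]] // _; exists a, b, c. Qed.

Lemma map_conj_tnth (gT : finGroupType) r (s s' : r.-tuple gT) (h : gT) :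
  [seq x ^ h | x <- s'] = s -> forall i, tnth s' i ^ h = tnth s i.
Proof.
by move=> eqs i; rewrite !(tnth_nth 1) -eqs (nth_map 1) // size_tuple.
Qed.

Lemma full_cycle_isog (T : finType) (s : {perm T}) :
  cycle_on (psupport s) s -> #|psupport s| = #|T| -> 0 < #|T| ->
    <[s]> \isog Zp #|T|.
Proof.
move=> [_ orbS] oS T0.
have orbT x : #|porbit s x| = #|T|.
  have memS : x \in psupport s.
    have -> : psupport s = setT by apply/eqP;
      rewrite eqEcard subsetT cardsT oS leqnn.
    by rewrite inE.
  by rewrite orbS ?oS.
have -> : #|T| = #[s]; last by rewrite isog_sym Zp_isog.
apply/eqP; rewrite eqn_leq; apply/andP; split.
  have [x _] : exists x, x \in T by apply/card_gt0P.
  by rewrite -(orbT x) card_porbit_order.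
apply: dvdn_leq => //; rewrite order_dvdn; apply/eqP/permP=> x.
by rewrite permX -(orbT x) iter_porbit perm1.
Qed.

Lemma cycle_pair_conj (T : finType) (s1 s2 t1 t2 : {perm T}) :
    cycle_on (psupport s1) s1 -> cycle_on (psupport t1) t1 ->
    #|psupport s1| = #|psupport t1| -> 0 < #|psupport s1| ->
    s1 * s2 = 1 -> t1 * t2 = 1 ->
  exists h : {perm T}, t1 ^ h = s1 /\ t2 ^ h = s2.
Proof.
move=> cs ct eqo o0 /eqP; rewrite -eq_invg_mul => /eqP <- /eqP;
  rewrite -eq_invg_mul => /eqP <-.
by have [h eqh] := cycle_on_conj cs ct eqo o0; exists h; rewrite conjVg eqh.
Qed.

(** Meant for [f = e - 1] with all lengths odd, hence [f >= 2]: two values of at least [d - 2] and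
    two further ones exceed the genus 0 total [2 * d - 2]. *)
Lemma sum_two_large r (f : 'I_r -> nat) d i j :
    3 < r -> i != j -> (forall k, 1 < f k) -> (d <= f i + 2)%N ->
      (d <= f j + 2)%N ->
  (2 * d < \sum_(k < r) f k + 2)%N.
Proof.
move=> r4 neq gt1 fi fj; rewrite (bigD1 i) //= (bigD1 j) 1?eq_sym //=.
have : (\sum_(k < r | (k != i) && (k != j)) 2 <=
  \sum_(k < r | (k != i) && (k != j)) f k)%N.
  by apply: leq_sum => k _; apply: gt1.
have : (\sum_(k < r) 2 = r * 2)%N by rewrite sum_nat_const card_ord.
rewrite (bigD1 i) //= (bigD1 j) 1?eq_sym //=.
move: (\sum_(k < r | _) 2)%N (\sum_(k < r | _) f k)%N => x y;
  move: (f i) (f j) fi fj => a b; lia.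
Qed.

Lemma perm_eq445 a b c : perm_eq [:: a; b; c] [:: 4; 4; 5] ->
  [\/ [/\ a = 4, b = 4 & c = 5], [/\ a = 4, b = 5 & c = 4] |
    [/\ a = 5, b = 4 & c = 4]].
Proof.
rewrite -mem_permutations.
have -> : permutations [:: 4; 4; 5] =
  [:: [:: 4; 4; 5]; [:: 4; 5; 4]; [:: 5; 4; 4]] by [].
by rewrite !inE => /or3P[] /eqP[-> -> ->];
  [apply: Or31 | apply: Or32 | apply: Or33].
Qed.

Lemma triple445 (T : finType) (A : {set {perm T}}) (s1 s2 s3 : {perm T}) :
    genus0_triple s1 s2 s3 ->
    #|psupport s1| = 4 -> #|psupport s2| = 4 -> #|psupport s3| = 5 ->
    A =i [:: s1; s2; s3] -> [primitive <<A>>, on [set: T] | 'P] ->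
  [/\ #|T| = 6, <<A>> \isog 'Sym_('I_5) & [transitive^2 <<A>>, on [set: T] | 'P]].
Proof.
move=> trip e1 e2 e3 defA primG; have [[_ _ c3] _ _ sum] := trip.
have oT : #|T| = 6 by move: sum; rewrite e1 e2 e3; lia.
have [A1 A3] : s1 \in A /\ s3 \in A by rewrite !defA !inE !eqxx !orbT.
(* The 5-cycle has one fixed point in degree 6, which gives [6 - 5 + 1 = 2]. *)
have tr2 : [transitive^2 <<A>>, on [set: T] | 'P].
  by apply: (cycle_on_ntrans (k := 0) primG (mem_gen A3) c3); rewrite e3 ?oT.
split=> //; apply: (triple445_isog trip e1 e2 e3 (mem_gen A1) _ tr2).
by apply: triple_gen_sub trip _ => p; rewrite defA.
Qed.

Theorem theorem5p3 (d r : nat) (e : r.-tuple nat)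
    (hd : (1 <= d)%N) (hr : (2 <= r)%N)
    (he : forall i : 'I_r, (2 <= tnth e i <= d)%N)
    (hgenus : (2 * d - 2 = \sum_(i < r) (tnth e i - 1))%N)
    (sigma sigma' : r.-tuple 'S_d)
    (hsigma : hurwitz_factorization e sigma)
    (hsigma' : hurwitz_factorization e sigma') :
  (exists tau : 'S_d,
      hurwitz_group sigma' :^ tau = hurwitz_group sigma /\
      (forall i : 'I_r,
          tnth sigma' i ^ tau \in tnth sigma i ^: hurwitz_group sigma)) /\
  [/\ r = 2 -> hurwitz_group sigma \isog Zp d,
      r = 3 /\ perm_eq e [:: 4; 4; 5] ->
        [/\ d = 6, hurwitz_group sigma \isog 'Sym_('I_5)
          & [transitive^2 hurwitz_group sigma, on [set: 'I_d] | 'P]]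
    & r <> 2 -> ~ (r = 3 /\ perm_eq e [:: 4; 4; 5]) ->
        (all odd e -> hurwitz_group sigma = 'Alt_('I_d) :> {set 'S_d}) /\
        (~~ all odd e -> hurwitz_group sigma = 'Sym_('I_d) :> {set 'S_d})].
Proof.
have gt1e i : 1 < tnth e i by case/andP: (he i).
have [cyc eE prod1 trG] := hurwitz_seq gt1e hsigma.
have [cyc' eE' prod1' trG'] := hurwitz_seq gt1e hsigma'.
have oT : #|'I_d| = d := card_ord d.
have tE i : tnth e i = #|psupport (tnth sigma i)| by rewrite {1}eE tnth_map.
have tE' i : tnth e i = #|psupport (tnth sigma' i)| by rewrite {1}eE' tnth_map.
have gt1 p : p \in tval sigma -> 1 < #|psupport p| by case/tnthP=> i ->;
  rewrite -tE.
have gt1' p : p \in tval sigma' -> 1 < #|psupport p| by case/tnthP=> i ->;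
  rewrite -tE'.
have sum : (\sum_(p <- sigma) (#|psupport p| - 1) = 2 * #|'I_d| - 2)%N.
  by rewrite oT hgenus big_tuple; apply: eq_bigr => i _; rewrite tE.
have sum' : (\sum_(p <- sigma') (#|psupport p| - 1) = 2 * #|'I_d| - 2)%N.
  by rewrite oT hgenus big_tuple; apply: eq_bigr => i _; rewrite tE'.

have conjE tau : [seq x ^ tau | x <- sigma'] = sigma -> exists tau : 'S_d,
    hurwitz_group sigma' :^ tau = hurwitz_group sigma /\
    (forall i, tnth sigma' i ^ tau \in tnth sigma i ^: hurwitz_group sigma).
  by move/map_conj_tnth/hurwitz_groupJ => conj_tau; exists tau.
have [r2 | neqr2] := eqVneq r 2.
  subst r.
  have [s1 [s2 eqs]] := seq_size2 (size_tuple sigma).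
  have [t1 [t2 eqt]] := seq_size2 (size_tuple sigma').
  have eq_supp := etrans (esym (congr1 val eE)) (congr1 val eE').
  rewrite /= eqs eqt in eq_supp; case: eq_supp => eq1 eq2.
  rewrite eqs !big_cons !big_nil mulg1 in cyc gt1 prod1 sum.
  rewrite eqt !big_cons !big_nil mulg1 in cyc' prod1'.
  have c1 := cyc s1 (mem_head _ _); have c1' := cyc' t1 (mem_head _ _).
  (* Two lengths that are at most [d] and add up to [2 * d] both equal [d]. *)
  have o1 : #|psupport s1| = #|'I_d|.
    have := max_card (psupport s1); have := max_card (psupport s2).
    by have := gt1 s1 (mem_head _ _); arith.
  split.
    have [|h [h1 h2]] := cycle_pair_conj c1 c1' eq1 _ prod1 prod1'.
      by rewrite o1 oT.
    by apply: (conjE h); rewrite eqt eqs /= h1 h2.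
  split=> // [_|[]//].
  have -> : hurwitz_group sigma = <[s1]>%G.
    apply/val_inj/eqP; rewrite /= eqEsubset !gen_subG /= eqs sub1set;
      apply/andP; split.
      apply/subsetP=> p; rewrite !inE => /orP[]/eqP->; first exact: cycle_id.
      have -> : s2 = s1^-1 by apply/esym/eqP; rewrite eq_invg_mul prod1.
      by rewrite groupV cycle_id.
    by rewrite mem_gen // !inE eqxx.
  by have := full_cycle_isog c1 o1; rewrite oT; apply.
have lt2r : 2 < size sigma by rewrite size_tuple ltn_neqAle eq_sym neqr2.
have lt2r' : 2 < size sigma' by rewrite size_tuple ltn_neqAle eq_sym neqr2.
have primG : [primitive hurwitz_group sigma, on [set: 'I_d] | 'P].
  exact: genus0_primitive cyc gt1 prod1 trG sum lt2r.
have group_eq : ~ (r = 3 /\ perm_eq e [:: 4; 4; 5]) ->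
    [/\ (all odd e -> hurwitz_group sigma = 'Alt_('I_d) :> {set 'S_d}),
        (~~ all odd e -> hurwitz_group sigma = 'Sym_('I_d) :> {set 'S_d}),
        (all odd e -> hurwitz_group sigma' = 'Alt_('I_d) :> {set 'S_d}) &
        (~~ all odd e -> hurwitz_group sigma' = 'Sym_('I_d) :> {set 'S_d})].
  move=> not445.
  have sub445 (s : r.-tuple 'S_d) :
    e = [tuple of [seq #|psupport p| | p : 'S_d <- s]] ->
      ~ (size s = 3 /\ perm_eq [seq #|psupport p| | p : 'S_d <- s] [:: 4; 4; 5]).
    by move=> es [s3 p445]; apply: not445; split;
      [rewrite -s3 size_tuple | rewrite es].
  have [HA HS] := genus0_group_eq cyc gt1
    (genus0_Alt cyc gt1 prod1 trG sum lt2r (sub445 _ eE)).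
  have [HA' HS'] := genus0_group_eq cyc' gt1'
    (genus0_Alt cyc' gt1' prod1' trG' sum' lt2r' (sub445 _ eE')).
  have oddE : all odd e = all (fun p : 'S_d => odd #|psupport p|) sigma.
    by rewrite {1}eE /= all_map.
  have oddE' : all odd e = all (fun p : 'S_d => odd #|psupport p|) sigma'.
    by rewrite {1}eE' /= all_map.
  by split; [rewrite oddE | rewrite oddE | rewrite oddE' | rewrite oddE'].
have tripleP (s : r.-tuple 'S_d) s1 s2 s3 : tval s = [:: s1; s2; s3] ->
    (forall p, p \in tval s -> cycle_on (psupport p) p) ->
    (forall p, p \in tval s -> 1 < #|psupport p|) -> \prod_(p <- s) p = 1 ->
    [transitive hurwitz_group s, on [set: 'I_d] | 'P] ->
    (\sum_(p <- s) (#|psupport p| - 1) = 2 * #|'I_d| - 2)%N ->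
    genus0_triple s1 s2 s3.
  move=> eqs cs gs ps; rewrite /hurwitz_group eqs in cs gs ps * => ts ss.
  exact: genus0_triple_of cs gs ps ts ss.
split; last split=> [/eqP r2 | [r3 e445] | _ /group_eq[]//].
- have [r3 | neqr3] := eqVneq r 3.
    have [s1 [s2 [s3 eqs]]] := seq_size3 (etrans (size_tuple sigma) r3).
    have [t1 [t2 [t3 eqt]]] := seq_size3 (etrans (size_tuple sigma') r3).
    have trip := tripleP _ _ _ _ eqs cyc gt1 prod1 trG sum.
    have trip' := tripleP _ _ _ _ eqt cyc' gt1' prod1' trG' sum'.
    have eq_supp := etrans (esym (congr1 val eE)) (congr1 val eE').
    rewrite /= eqs eqt in eq_supp; case: eq_supp => eq1 eq2 eq3.
    have [h [h1 h2 h3]] := genus0_triple_conj trip trip' eq1 eq2 eq3.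
    by apply: (conjE h); rewrite eqt eqs /= h1 h2 h3.
  have r4 : 3 < r by rewrite ltn_neqAle eq_sym neqr3 -(size_tuple sigma).
  have [|HA HS HA' HS'] := group_eq; first by case=> r3; rewrite r3 in neqr3.
  have conj_i i : exists h, tnth sigma' i ^ h = tnth sigma i.
    apply: (cycle_on_conj (cyc _ _) (cyc' _ _)); rewrite ?mem_tnth -?tE -?tE' //.
    exact: ltnW (gt1e i).
  have conj_i' i tau : exists k, tnth sigma i ^ k = tnth sigma' i ^ tau.
    by have [h <-] := conj_i i; exists (h^-1 * tau); rewrite conjgM conjgK.
  (* With an even length both groups are the full symmetric group, where the cycle length decides
     conjugacy, so [tau = 1] works. *)
  have [odd_e | even_e] := boolP (all odd e); last first.
    exists 1; rewrite conjsg1; split=> [|i]; first by rewrite HS ?HS'.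
    by have [k <-] := conj_i' i 1; rewrite memJ_class // HS ?inE.
  have uniq_large i j : d <= tnth e i + 1 -> d <= tnth e j + 1 -> i = j.
    move=> di dj; apply/eqP/negPn/negP => neq.
    have gt1f k : 1 < tnth e k - 1.
      have := allP odd_e _ (mem_tnth k e); have := gt1e k.
      by case: (tnth e k) => [|[|[|m]]].
    have ltf k : d <= tnth e k + 1 -> d <= (tnth e k - 1) + 2.
      by move=> dk; have := gt1e k; clear -dk; lia.
    have := sum_two_large r4 neq gt1f (ltf i di) (ltf j dj).
    by rewrite -hgenus; clear -hd; lia.
  have [tau tauE] : exists tau, forall i, d <= tnth e i + 1 ->
    tnth sigma' i ^ tau = tnth sigma i.
    have [i di | noi] := pickP [pred i | d <= tnth e i + 1]; last first.
      by exists 1 => i di; have := noi i; rewrite /= di.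
    by have [h eqh] := conj_i i; exists h => j dj; rewrite -(uniq_large i j).
  exists tau; split=> [|i].
    by rewrite HA' // HA //; apply: (normsP (Alt_norm _)); exact: in_setT.
  have [large | small] := leqP d (tnth e i + 1);
    first by rewrite tauE // class_refl.
  have [k eqk] := conj_i' i tau; rewrite HA //.
  by apply: (class_Alt _ eqk); rewrite -tE oT; clear -small; lia.
- by rewrite r2 in neqr2.
have [s1 [s2 [s3 eqs]]] := seq_size3 (etrans (size_tuple sigma) r3).
have trip := tripleP _ _ _ _ eqs cyc gt1 prod1 trG sum.
rewrite {1}eE /= eqs in e445; rewrite -[d in d = 6]oT.
have trip' := genus0_triple_rot trip; have trip'' := genus0_triple_rot trip'.
(* A rotation of the triple puts the 5-cycle last and keeps the set of generators. *)
have [[e1 e2 e3]|[e1 e2 e3]|[e1 e2 e3]] := perm_eq445 e445.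
- by apply: (triple445 trip e1 e2 e3 _ primG) => p; rewrite eqs inE.
- apply: (triple445 trip'' e3 e1 e2 _ primG) => p; rewrite eqs !inE.
  by rewrite orbCA orbC -!orbA orbCA.
- apply: (triple445 trip' e2 e3 e1 _ primG) => p; rewrite eqs !inE.
  by rewrite orbC -orbA.
Qed.
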